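(* Let $R$ be a $GL_N$ type Hecke symmetry on $V$, $\dim_{\mathbb{C}}V=N$, with $q$ generic. Let $W^{(1)}=\mathrm{Tr}_R\hat L=\mathrm{Tr}_R(MD)$ be the first quantum cut-and-join operator, acting on $\mathcal{M}(R)$ by the action $\triangleright$ described in the context. Then for any partition $\lambda=(\lambda_1,\lambda_2,\dots,\lambda_N)$, $\lambda\vdash k\in\mathbb{Z}_+$, $$ W^{(1)}\triangleright s_\lambda(M)=\chi_\lambda(\mathrm{Tr}_R\hat L)\,s_\lambda(M), $$ where the $\lambda$-character of $W^{(1)}$ is $$ \chi_\lambda(\mathrm{Tr}_R\hat L)=\frac{1}{q^{2N}}\sum_{i=1}^k q^{-2c(i)}=\frac{1}{q^{2N}}\sum_{i=1}^N q^{-(\lambda_i+1-2i)}(\lambda_i)_q . $$ In the first sum $c(i)$ is the content of the box containing the integer $i$ in a standard Young table of shape $\lambda$ (so the sum is over all boxes of the Young diagram of $\lambda$).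
   Context: **Hecke symmetries.** $V$ is a complex vector space of dimension $N$. A Hecke symmetry is a linear operator $R:V^{\otimes 2}\to V^{\otimes 2}$ satisfying the braid relation $(R\otimes I)(I\otimes R)(R\otimes I)=(I\otimes R)(R\otimes I)(I\otimes R)$ and the Hecke condition $(qI-R)(q^{-1}I+R)=0$, where $q\in\mathbb{C}\setminus\{0,\pm1\}$ is generic, in particular $q^k\ne 1$ for all integers $k>1$. $I$ denotes an identity operator or unit matrix. Put $n_q=(q^n-q^{-n})/(q-q^{-1})$. $R$ is skew-invertible if there is $\Psi\in\mathrm{End}(V^{\otimes 2})$ with $\mathrm{Tr}_{(2)}R_{12}\Psi_{23}=\mathrm{Tr}_{(2)}\Psi_{12}R_{23}=P_{13}$, where $P$ is the flip and indices indicate the tensor factors. In this case put $C=\mathrm{Tr}_{(2)}\Psi_{12}\in\mathrm{End}(V)$; the $R$-trace of an $N\times N$ matrix $X$ is $\mathrm{Tr}_R X=\mathrm{Tr}(CX)$, and $\mathrm{Tr}_{R(1\dots k)}=\mathrm{Tr}_{R(1)}\cdots\mathrm{Tr}_{R(k)}$ is the $R$-trace taken over all $k$ tensor factors of $V^{\otimes k}$. $R$ is even of rank $m$ if the Poincaré-Hilbert series of the $R$-skew-symmetric algebra $\Lambda_R(V)=T(V)/\langle \mathrm{Im}(q^{-1}I+R)\rangle$ is a monic polynomial of degree $m$. A $GL_m$ type Hecke symmetry is a skew-invertible even Hecke symmetry of rank $m$; here $m=N=\dim V$. **Algebras.** With $X_1=X\otimes I$: $\mathcal{M}(R)$ is the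 unital associative algebra generated by the entries of the $N\times N$ matrix $M=\|m_i^j\|$ with relations $RM_1RM_1=M_1RM_1R$. The modified reflection equation algebra $\hat{\mathcal{L}}(R)$ is generated by the entries of $\hat L=\|\hat l_i^j\|$ with relations $R\hat L_1R\hat L_1-\hat L_1R\hat L_1R=R\hat L_1-\hat L_1R$. Setting $L=I-(q-q^{-1})\hat L$ one gets another set of generators $l_i^j$ of the same algebra, satisfying $RL_1RL_1=L_1RL_1R$; in these generators the algebra is denoted $\mathcal{L}(R)$. **Copies.** $R_i=I^{\otimes(i-1)}\otimes R\otimes I^{\otimes(k-i-1)}$ acts on $V^{\otimes k}$. For $X=L$ or $M$ put $X_{\overline 1}=X_{\underline 1}=X_1$, $X_{\overline{i+1}}=R_iX_{\overline i}R_i^{-1}$, $X_{\underline{i+1}}=R_i^{-1}X_{\underline i}R_i$. **Hecke algebra and idempotents.** $H_k(q)$ is generated by $1,\tau_1,\dots,\tau_{k-1}$ with $\tau_i\tau_{i+1}\tau_i=\tau_{i+1}\tau_i\tau_{i+1}$, $\tau_i\tau_j=\tau_j\tau_i$ for $|i-j|\ge2$, and $(q1-\tau_i)(q^{-1}1+\tau_i)=0$. Its $R$-matrix representation on $V^{\otimes k}$ is $\tau_i\mapsto R_i$. The Jucys-Murphy elements are $J_1=1$, $J_i=\tau_{i-1}J_{i-1}\tau_{i-1}$, $2\le i\le k$; the same symbols denote their images in the $R$-matrix representation. The content of the box of a Young diagram in row $m$ and column $n$ is $c=n-m$. For a partition $\lambda\vdash k$ and a standard Young table $(\lambda,a)$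 of shape $\lambda$, $P_{(\lambda,a)}\in H_k(q)$ is the (unique) primitive idempotent with $J_iP_{(\lambda,a)}=P_{(\lambda,a)}J_i=q^{2c(i)}P_{(\lambda,a)}$ for $1\le i\le k$, where $c(i)$ is the content of the box of $(\lambda,a)$ containing $i$. $P_{(\lambda,a)}(R)$ is its image in the $R$-matrix representation on $V^{\otimes k}$. **Schur polynomials.** For $\lambda\vdash k$, $s_\lambda(M)=\mathrm{Tr}_{R(1\dots k)}\big(P_{(\lambda,a)}(R)M_1M_{\overline2}\cdots M_{\overline k}\big)\in\mathcal{M}(R)$; this is independent of the choice of the standard table $(\lambda,a)$ of shape $\lambda$. **Action.** The quantum double of $\hat{\mathcal{L}}(R)$ and $\mathcal{M}(R)$ is the algebra generated by both algebras with the permutation relation $R\hat L_1RM_1=M_1R\hat L_1R^{-1}+RM_1$, equivalently $RL_1RM_1=M_1RL_1R^{-1}$; the corresponding permutation map, compatible with the algebra structures, is $\sigma:\mathcal{L}(R)\otimes\mathcal{M}(R)\to\mathcal{M}(R)\otimes\mathcal{L}(R)$. The counit $\varepsilon$ is the algebra homomorphism to $\mathbb{C}$ with $\varepsilon(l_i^j)=\delta_i^j$ (equivalently $\varepsilon(\hat l_i^j)=0$). The action on $\mathcal{M}(R)$ is $a\triangleright b=(\mathrm{Id}\otimes\varepsilon)\sigma(a\otimes b)$. Explicitly, $L_{\underline{k+1}}\triangleright M_1M_{\overline2}\cdots M_{\overline k}=J_{k+1}^{-1}M_1M_{\overline2}\cdots M_{\overline k}$ on $V^{\otimes(k+1)}$,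 where $\triangleright$ between matrices means that in each entry of the matrix product the element of $\mathcal{L}(R)$ is applied as an operator to the element of $\mathcal{M}(R)$. **Quantum partial derivatives.** $D=M^{-1}\hat L$ is the matrix of quantum partial derivatives, satisfying $R^{-1}D_1R^{-1}D_1=D_1R^{-1}D_1R^{-1}$ and $D_1RM_1R=RM_1R^{-1}D_1+R$; thus $\hat L=MD$. The $\lambda$-character of an operator is its eigenvalue on $s_\lambda(M)$. *)

(* Defs.v *)
From HB Require Import structures.
From mathcomp Require Import all_boot all_order all_algebra.
From mathcomp Require Import generic_quotient ring_quotient.
From mathcomp Require Import boolp reals.
From mathcomp Require Import complex.
From mathcomp Require Import finmap monalg.

Set Implicit Arguments.
Unset Strict Implicit.
Unset Printing Implicit Defensive.

Import GRing.Theory.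
Local Open Scope ring_scope.
Local Open Scope quotient_scope.

Section QuotientModule.
Variables (F : fieldType) (V : lmodType F) (S : V -> Prop).

Inductive span : V -> Prop :=
| span0 : span 0
| spanD c v w : S v -> span w -> span (c *: v + w).

Lemma span_add v w : span v -> span w -> span (v + w).
Proof.
by elim=> [|c u v' Su _ IH] Hw; rewrite ?add0r // -addrA; apply: spanD Su (IH Hw).
Qed.

Lemma span_scale c v : span v -> span (c *: v).
Proof.
elim=> [|d u w Su _ IH]; first by rewrite scaler0; exact: span0.
by rewrite scalerDr scalerA; apply: spanD Su IH.
Qed.

Lemma span_gen v : S v -> span v.
Proof. by move=> Sv; rewrite -[v]scale1r -[_ *: v]addr0; exact: spanD Sv span0. Qed.

Definition spanb : V -> bool := fun v => `[< span v >].

Lemma spanb_zmod_closed : zmod_closed spanb.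
Proof.
split=> [|v w]; first by apply/asboolP; exact: span0.
move=> /asboolP Hv /asboolP Hw; apply/asboolP; apply: span_add Hv _.
by rewrite -scaleN1r; apply: span_scale.
Qed.

HB.instance Definition _ := GRing.isZmodClosed.Build V spanb spanb_zmod_closed.

(* V / span S *)
Definition lquot := Quotient.quot (GRing.ZmodClosed.clone V spanb _).
HB.instance Definition _ := GRing.Zmodule.on lquot.

Definition lpi (v : V) : lquot := \pi_(lquot) v.

Lemma lpi_eqP v w : reflect (span (v - w)) (lpi v == lpi w).
Proof.
apply: (iffP idP) => [|H].
  by rewrite /lpi -Quotient.idealrBE => /asboolP.
by rewrite /lpi -Quotient.idealrBE; apply/asboolP.
Qed.

Lemma lpi_repr (x : lquot) : lpi (repr x) = x.
Proof. exact: reprK. Qed.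

Lemma lpi_zmod : zmod_morphism lpi.
Proof. by move=> v w; rewrite /lpi raddfB. Qed.
HB.instance Definition _ := GRing.isZmodMorphism.Build V lquot lpi lpi_zmod.

Definition lscale c (x : lquot) : lquot := lpi (c *: repr x).

Lemma lscale_pi c v : lscale c (lpi v) = lpi (c *: v).
Proof.
apply/eqP/lpi_eqP; rewrite -scalerBr; apply: span_scale.
by apply/lpi_eqP; rewrite lpi_repr.
Qed.

Lemma lscaleA c d x : lscale c (lscale d x) = lscale (c * d) x.
Proof. by rewrite -(lpi_repr x) !lscale_pi scalerA. Qed.
Lemma lscale1 : left_id 1 lscale.
Proof. by move=> x; rewrite -(lpi_repr x) lscale_pi scale1r. Qed.
Lemma lscaleDr : right_distributive lscale +%R.
Proof.
move=> c x y; rewrite -(lpi_repr x) -(lpi_repr y) -raddfD !lscale_pi.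
by rewrite scalerDr raddfD.
Qed.
Lemma lscaleDl x : {morph lscale^~ x : c d / c + d}.
Proof. by move=> c d; rewrite -(lpi_repr x) !lscale_pi scalerDl raddfD. Qed.

HB.instance Definition _ :=
  GRing.Zmodule_isLmodule.Build F lquot lscaleA lscale1 lscaleDr lscaleDl.

Lemma lpi_scalable : scalable lpi.
Proof. by move=> c v; rewrite -lscale_pi. Qed.
HB.instance Definition _ := GRing.isScalable.Build F V lquot *:%R lpi lpi_scalable.

End QuotientModule.


Section QuotientAlgebra.
Variables (F : fieldType) (B : algType F) (S : B -> Prop).

Inductive ideal_gen : B -> Prop :=
  IdealGen x r y : S r -> ideal_gen (x * r * y).

(* B modulo the two-sided ideal generated by S *)
Definition aquot := lquot ideal_gen.
HB.instance Definition _ := GRing.Lmodule.on aquot.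

Definition api : B -> aquot := lpi ideal_gen.
HB.instance Definition _ := GRing.Linear.on api.

Lemma api_repr (x : aquot) : api (repr x) = x. Proof. exact: lpi_repr. Qed.

Lemma api_eqP x y : reflect (span ideal_gen (x - y)) (api x == api y).
Proof. exact: lpi_eqP. Qed.

Lemma span_mulr x y : span ideal_gen x -> span ideal_gen (x * y).
Proof.
elim=> [|c v w [x' r y' Hr] _ IH]; first by rewrite mul0r; exact: span0.
rewrite mulrDl -scalerAl; apply: spanD IH.
by rewrite -!mulrA mulrA; exact: IdealGen.
Qed.

Lemma span_mull x y : span ideal_gen x -> span ideal_gen (y * x).
Proof.
elim=> [|c v w [x' r y' Hr] _ IH]; first by rewrite mulr0; exact: span0.
rewrite mulrDr -scalerAr; apply: spanD IH.
by rewrite !mulrA; exact: IdealGen.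
Qed.

Fact amul_key : unit. Proof. by []. Qed.
Definition amul : aquot -> aquot -> aquot :=
  locked_with amul_key (fun x y => api (repr x * repr y)).

Lemma amul_pi x y : amul (api x) (api y) = api (x * y).
Proof.
rewrite /amul unlock; apply/eqP/api_eqP.
have Hx : span ideal_gen (repr (api x) - x) by apply/api_eqP; rewrite api_repr.
have Hy : span ideal_gen (repr (api y) - y) by apply/api_eqP; rewrite api_repr.
rewrite -[_ - _](subrKA (repr (api x) * y)) -mulrBr -mulrBl.
by apply: span_add; [exact: span_mull | exact: span_mulr].
Qed.

Lemma amulA : associative amul.
Proof.
move=> x y z; rewrite -(api_repr x) -(api_repr y) -(api_repr z).
by rewrite !amul_pi mulrA.
Qed.
Lemma amul1 : left_id (api 1) amul.
Proof. by move=> x; rewrite -(api_repr x) amul_pi mul1r. Qed.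
Lemma amulr1 : right_id (api 1) amul.
Proof. by move=> x; rewrite -(api_repr x) amul_pi mulr1. Qed.
Lemma amulDl : left_distributive amul +%R.
Proof.
move=> x y z; rewrite -(api_repr x) -(api_repr y) -(api_repr z).
by rewrite -raddfD !amul_pi mulrDl raddfD.
Qed.
Lemma amulDr : right_distributive amul +%R.
Proof.
move=> x y z; rewrite -(api_repr x) -(api_repr y) -(api_repr z).
by rewrite -raddfD !amul_pi mulrDr raddfD.
Qed.
Lemma amul_scalerAl (c : F) x y : c *: amul x y = amul (c *: x) y.
Proof.
rewrite -(api_repr x) -(api_repr y) -linearZ !amul_pi -linearZ.
by rewrite scalerAl.
Qed.
Lemma amul_scalerAr (c : F) x y : c *: amul x y = amul x (c *: y).
Proof.
rewrite -(api_repr x) -(api_repr y) -linearZ !amul_pi -linearZ.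
by rewrite scalerAr.
Qed.

Section Morphism.
Variables (A : algType F) (f : {lrmorphism B -> A}).
Hypothesis fS : forall r, S r -> f r = 0.

Lemma lrmorph_span x : span ideal_gen x -> f x = 0.
Proof.
elim=> [|c v w [x' r y' Hr] _ IH]; first exact: raddf0.
by rewrite linearP /= IH !rmorphM /= (fS Hr) mulr0 mul0r scaler0 addr0.
Qed.

Definition alift (x : aquot) : A := f (repr x).

Lemma alift_pi x : alift (api x) = f x.
Proof.
apply/eqP; rewrite -subr_eq0 -raddfB; apply/eqP/lrmorph_span.
by apply/api_eqP; rewrite api_repr.
Qed.

Lemma alift_zmod : zmod_morphism alift.
Proof.
by move=> x y; rewrite -(api_repr x) -(api_repr y) -raddfB !alift_pi raddfB.
Qed.

Lemma alift1 : alift (api 1) = 1. Proof. by rewrite alift_pi rmorph1. Qed.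

Lemma aliftM x y : alift (amul x y) = alift x * alift y.
Proof.
by rewrite -(api_repr x) -(api_repr y) amul_pi !alift_pi rmorphM.
Qed.

Lemma alift_scalable : scalable alift.
Proof. by move=> c x; rewrite -(api_repr x) -linearZ !alift_pi linearZ. Qed.

Lemma api1_neq0 : api 1 != 0.
Proof.
apply/negP; rewrite -(raddf0 api) => /api_eqP; rewrite subr0.
by move=> /lrmorph_span /eqP; rewrite rmorph1 oner_eq0.
Qed.
End Morphism.

Lemma api_gen r : S r -> api r = 0.
Proof.
move=> Hr; apply/eqP; rewrite -(raddf0 api); apply/api_eqP; rewrite subr0.
by apply: span_gen; rewrite -[r]mulr1 -[r]mul1r; exact: IdealGen.
Qed.

End QuotientAlgebra.

Section FreeAlgebra.
Variables (F : fieldType) (T : choiceType).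

(* noncommutative polynomials F<T> *)
Definition falg := {malg F[{fmonom T}]}.
HB.instance Definition _ := GRing.Lalgebra.on falg.

Definition fgen (t : T) : falg := << fmu t >>%R.

Lemma falg_scalerAr (c : F) (x y : falg) : c *: (x * y) = x * (c *: y).
Proof.
apply/malgP=> m.
rewrite mcoeffZ [in LHS]mcoeffMl.
rewrite [in RHS](mcoeffMlw _ (fsubset_refl _) (msuppZ_le c y)).
rewrite mulr_sumr; apply: eq_bigr => i _; rewrite mulr_sumr.
by apply: eq_bigr => j _; rewrite mcoeffZ mulrnAr mulrCA.
Qed.
HB.instance Definition _ :=
  GRing.Lalgebra_isAlgebra.Build F falg falg_scalerAr.

Variables (A : algType F) (f : T -> A).

Definition evalm (m : {fmonom T}) : A := \prod_(t <- (m : seq T)) f t.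

Lemma evalm_mmorphism : mmorphism evalm.
Proof. by split=> [m n|]; rewrite /evalm ?fmM ?big_cat // fm1 big_nil. Qed.
HB.instance Definition _ :=
  isMultiplicative.Build {fmonom T} A evalm evalm_mmorphism.

(* the algebra morphism F<T> -> A with t |-> f t *)
Definition feval (x : falg) : A := mmap (in_alg A) evalm x.

Lemma feval_zmod : zmod_morphism feval.
Proof. by move=> x y; rewrite /feval raddfB. Qed.
HB.instance Definition _ := GRing.isZmodMorphism.Build falg A feval feval_zmod.

Lemma feval_monoid : monoid_morphism feval.
Proof.
have [] := @commr_mmap_is_multiplicative _ F A (in_alg A) evalm.
  by move=> g m m'; rewrite /GRing.comm /= -scalerAl mul1r -scalerAr mulr1.
by move=> HM H1; split.
Qed.
HB.instance Definition _ := GRing.isMonoidMorphism.Build falg A feval feval_monoid.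

Lemma feval_scalable : scalable feval.
Proof. by move=> c x; rewrite /feval mmapZ /= mulr_algl. Qed.
HB.instance Definition _ := GRing.isScalable.Build F falg A *:%R feval feval_scalable.

Lemma feval_gen t : feval (fgen t) = f t.
Proof. by rewrite /feval mmapU /evalm fmU big_seq1 /= scale1r mul1r. Qed.

Lemma feval_alg c : feval c%:A = c%:A.
Proof. by rewrite linearZ /= rmorph1. Qed.

End FreeAlgebra.

(* Generators and relations.  MathComp rings are non-trivial by definition, so a
   presentation comes with a point [aug] of F^T at which all relators vanish;
   it induces a character of the presented algebra, see [palg_aug]. *)
Record presentation (F : fieldType) (T : choiceType) := Presentation {
  relator : falg F T -> Prop;
  aug : T -> F^o;
  aug_relator : forall r, relator r -> feval aug r = 0 }.

Section PresentedAlgebra.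
Variables (F : fieldType) (T : choiceType) (Pr : presentation F T).

(* F<T> modulo the two-sided ideal generated by the relators *)
Definition palg := aquot (relator Pr).
HB.instance Definition _ := GRing.Lmodule.on palg.

HB.instance Definition _ := GRing.Zmodule_isNzRing.Build palg
  (@amulA _ _ _) (@amul1 _ _ _) (@amulr1 _ _ _) (@amulDl _ _ _) (@amulDr _ _ _)
  (api1_neq0 (@aug_relator _ _ Pr)).
HB.instance Definition _ :=
  GRing.Lmodule_isLalgebra.Build F palg (@amul_scalerAl _ _ _).
HB.instance Definition _ :=
  GRing.Lalgebra_isAlgebra.Build F palg (@amul_scalerAr _ _ _).

Definition ppi : falg F T -> palg := @api F (falg F T) (relator Pr).

Lemma ppi_zmod : zmod_morphism ppi. Proof. exact: raddfB. Qed.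
HB.instance Definition _ := GRing.isZmodMorphism.Build (falg F T) palg ppi ppi_zmod.
Lemma ppi_monoid : monoid_morphism ppi.
Proof. by split=> // x y; exact/esym/amul_pi. Qed.
HB.instance Definition _ :=
  GRing.isMonoidMorphism.Build (falg F T) palg ppi ppi_monoid.
Lemma ppi_scalable : scalable ppi.
Proof. by move=> c x; rewrite /ppi linearZ. Qed.
HB.instance Definition _ :=
  GRing.isScalable.Build F (falg F T) palg *:%R ppi ppi_scalable.

Lemma ppi_relator r : relator Pr r -> ppi r = 0.
Proof. exact: api_gen. Qed.

Definition pgen (t : T) : palg := ppi (fgen F t).

Section Lift.
Variables (A : algType F) (f : T -> A).
Hypothesis Hf : forall r, relator Pr r -> feval f r = 0.

Definition palg_lift (_ : forall r, relator Pr r -> feval f r = 0) : palg -> A :=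
  alift (feval f : {lrmorphism falg F T -> A}).

Local Notation lift := (palg_lift Hf).

HB.instance Definition _ :=
  GRing.isZmodMorphism.Build palg A lift (alift_zmod Hf).
Lemma palg_lift_monoid : monoid_morphism lift.
Proof. by split; [exact: alift1 Hf | exact: aliftM Hf]. Qed.
HB.instance Definition _ :=
  GRing.isMonoidMorphism.Build palg A lift palg_lift_monoid.
HB.instance Definition _ :=
  GRing.isScalable.Build F palg A *:%R lift (alift_scalable Hf).

Lemma palg_lift_gen t : lift (pgen t) = f t.
Proof. by rewrite [LHS](alift_pi Hf); exact: feval_gen. Qed.

End Lift.

(* the character t |-> aug t *)
Definition palg_aug : palg -> F^o := palg_lift (@aug_relator _ _ Pr).
HB.instance Definition _ := GRing.LRMorphism.on palg_aug.

Lemma palg_aug_gen t : palg_aug (pgen t) = aug Pr t.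
Proof. exact: palg_lift_gen. Qed.

End PresentedAlgebra.

Section Tensor.
Variables (F : fieldType) (U V : lmodType F).

Local Notation free := {malg F[(U * V)%type]}.

Inductive bilin_relator : free -> Prop :=
| BilinL c u u' v :
    bilin_relator (<< (c *: u + u', v) >> - c *: << (u, v) >> - << (u', v) >>)
| BilinR c u v v' :
    bilin_relator (<< (u, c *: v + v') >> - c *: << (u, v) >> - << (u, v') >>).

Definition tensor := lquot bilin_relator.
HB.instance Definition _ := GRing.Lmodule.on tensor.

Definition tens (u : U) (v : V) : tensor := lpi bilin_relator << (u, v) >>.

(* The linear map on U (x) V induced by f, for f bilinear: [tlift_tens]. *)
Definition tlift (W : lmodType F) (f : U -> V -> W) (x : tensor) : W :=
  \sum_(p <- msupp (repr x)) (repr x)@_p *: f p.1 p.2.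

Section Lift.
Variables (W : lmodType F) (f : U -> V -> W).
Hypothesis fl : forall v, linear (f^~ v).
Hypothesis fr : forall u, linear (f u).

Let g (x : free) : W := \sum_(p <- msupp x) x@_p *: f p.1 p.2.

Let gE (d : {fset (U * V)%type}) x : (msupp x `<=` d)%fset ->
  g x = \sum_(p <- d) x@_p *: f p.1 p.2.
Proof.
move=> le; rewrite /g (big_fset_incl _ le) //= => p _ /mcoeff_outdom ->.
by rewrite scale0r.
Qed.

Let g_lin c x y : g (c *: x + y) = c *: g x + g y.
Proof.
pose d := (msupp (c *: x + y) `|` (msupp x `|` msupp y))%fset.
rewrite !(@gE d) ?fsubsetUl // /d.
- rewrite scaler_sumr -big_split /=; apply: eq_bigr => p _.
  by rewrite mcoeffD mcoeffZ scalerDl scalerA.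
- exact: fsubset_trans (fsubsetUr _ _) (fsubsetUr _ _).
- exact: fsubset_trans (fsubsetUl _ _) (fsubsetUr _ _).
Qed.

Let g0 : g 0 = 0. Proof. by rewrite /g msupp0 big_seq_fset0. Qed.

Let gU u v : g << (u, v) >> = f u v.
Proof. by rewrite (gE msuppU_le) big_seq_fset1 mcoeffUU scale1r. Qed.

Let gB a b : g (a - b) = g a - g b.
Proof. by rewrite [a - b]addrC -[- b]scaleN1r g_lin scaleN1r addrC. Qed.

Let g_span x : span bilin_relator x -> g x = 0.
Proof.
have gZ c a : g (c *: a) = c *: g a by rewrite -[c *: a]addr0 g_lin g0 addr0.
elim=> // c v w Hv _ IH; rewrite g_lin IH addr0.
case: Hv => [c' u u' v'|c' u v' w']; rewrite !gB gZ !gU ?fl ?fr.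
  by rewrite addrAC addrK subrr scaler0.
by rewrite addrAC addrK subrr scaler0.
Qed.

Lemma tlift_linear : linear (tlift f).
Proof.
move=> c x y; rewrite -[LHS]/(g _) -[tlift f x]/(g _) -[tlift f y]/(g _).
rewrite -g_lin; apply/eqP; rewrite -subr_eq0 -gB; apply/eqP/g_span/lpi_eqP.
by rewrite lpi_repr linearP /= !lpi_repr.
Qed.

Lemma tlift_tens u v : tlift f (tens u v) = f u v.
Proof.
rewrite -gU -[LHS]/(g _); apply/eqP; rewrite -subr_eq0 -gB; apply/eqP/g_span.
by apply/lpi_eqP; rewrite lpi_repr.
Qed.

End Lift.
End Tensor.

(* An operator on V^{(x) k}, V = F^N, is a matrix whose rows and columns are
   labelled by multi-indices a : {ffun 'I_k -> 'I_N}; it acts on column vectors, so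
   composition is [*m].  Tensor factors and boxes are numbered from 0. *)
Definition tmx (N k : nat) (A : Type) := 'M[A]_#|{ffun 'I_k -> 'I_N}|.

Section TensorOperators.
Variables (N : nat) (A : pzRingType).

Definition tmx_of k (f : {ffun 'I_k -> 'I_N} -> {ffun 'I_k -> 'I_N} -> A)
  : tmx N k A := \matrix_(i, j) f (enum_val i) (enum_val j).

Definition tent k (X : tmx N k A) (a b : {ffun 'I_k -> 'I_N}) : A :=
  X (enum_rank a) (enum_rank b).

(* X acting on the factors s_0, ..., s_(m-1) of V^{(x) k} (s without repetition) *)
Definition legs k m (s : m.-tuple 'I_k) (X : tmx N m A) : tmx N k A :=
  tmx_of (fun a b =>
    if [forall l, (l \notin s) ==> (a l == b l)]
    then tent X [ffun l => a (tnth s l)] [ffun l => b (tnth s l)] else 0).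

Definition leg1 k (l0 : 'I_k) (X : 'M[A]_N) : tmx N k A :=
  tmx_of (fun a b =>
    if [forall l, (l != l0) ==> (a l == b l)] then X (a l0) (b l0) else 0).

(* X on the factors i, i+1; the identity if these are not factors of V^{(x) k} *)
Definition adj k (X : tmx N 2 A) (i : nat) : tmx N k A :=
  match insub i, insub i.+1 with
  | Some l, Some l' => legs [tuple l; l'] X
  | _, _ => 1%:M
  end.

Definition insert k (l0 : 'I_k.+1) (x : 'I_N) (a : {ffun 'I_k -> 'I_N})
  : {ffun 'I_k.+1 -> 'I_N} :=
  [ffun l => if unlift l0 l is Some l' then a l' else x].

(* partial trace over the factor l0 *)
Definition ptr k (l0 : 'I_k.+1) (X : tmx N k.+1 A) : tmx N k A :=
  tmx_of (fun a b => \sum_(x < N) tent X (insert l0 x a) (insert l0 x b)).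

Definition flip : tmx N 2 A :=
  tmx_of (fun a b => ((a ord0 == b ord_max) && (a ord_max == b ord0))%:R).

End TensorOperators.

Section HeckeSymmetry.
Variables (F : fieldType) (N : nat) (q : F) (R : tmx N 2 F).

Definition generic : Prop :=
  [/\ q != 0, q != 1, q != -1 & forall k : nat, (1 < k)%N -> q ^+ k != 1].

Definition hecke_symmetry : Prop :=
  adj 3 R 0 *m adj 3 R 1 *m adj 3 R 0 = adj 3 R 1 *m adj 3 R 0 *m adj 3 R 1
  /\ (q%:M - R) *m (q^-1%:M + R) = 0.

Definition skew_inverse (Psi : tmx N 2 F) : Prop :=
  ptr (inord 1 : 'I_3) (adj 3 R 0 *m adj 3 Psi 1) = flip N F
  /\ ptr (inord 1 : 'I_3) (adj 3 Psi 0 *m adj 3 R 1) = flip N F.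

(* The degree k part of the two-sided ideal of T(V) generated by
   Im (q^-1 + R) is the sum of the images of q^-1 + R_i in V^{(x) k}.  Images are
   column spaces, hence the transposition. *)
Definition dim_Lambda (k : nat) : nat :=
  #|{ffun 'I_k -> 'I_N}| - \rank (\sum_(i < k.-1) (q^-1%:M + adj k R i)^T)%MS.

Definition even_of_rank (m : nat) : Prop :=
  exists p : {poly int},
    [/\ p \is monic, size p = m.+1 & forall k, p`_k = (dim_Lambda k)%:Z].

Definition GL_type (m : nat) : Prop :=
  [/\ hecke_symmetry, exists Psi, skew_inverse Psi & even_of_rank m].

End HeckeSymmetry.

Section RTrace.
Variables (F : fieldType) (N : nat).

Definition Cmx (Psi : tmx N 2 F) : 'M[F]_N :=
  \matrix_(i, j) \sum_(x < N)
    tent Psi [ffun l => if l == ord0 then i else x]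
             [ffun l => if l == ord0 then j else x].

Variables (A : lalgType F) (C : 'M[F]_N).

Definition Rtr (X : 'M[A]_N) : A := \tr (map_mx (in_alg A) C *m X).

(* Tr_{R(1..k)} = Tr_{R(1)} ... Tr_{R(k)}; V^{(x) 0} is the ground field *)
Fixpoint Rtrs (k : nat) : tmx N k A -> A :=
  match k with
  | 0 => fun X => \tr X
  | k'.+1 => fun X =>
      Rtrs (ptr ord_max (leg1 ord_max (map_mx (in_alg A) C) *m X))
  end.

End RTrace.

Section MatrixRelations.
Variables (F : fieldType) (N : nat) (q : F) (R : tmx N 2 F).

Definition gens := ('I_N * 'I_N)%type.

Section Over.
Variable A : lalgType F.

Definition Rin : tmx N 2 A := map_mx (in_alg A) R.
Definition fst1 (X : 'M[A]_N) : tmx N 2 A := leg1 ord0 X.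

(* R M_1 R M_1 - M_1 R M_1 R *)
Definition RE (X : 'M[A]_N) : tmx N 2 A :=
  Rin *m fst1 X *m Rin *m fst1 X - fst1 X *m Rin *m fst1 X *m Rin.

(* R L_1 R L_1 - L_1 R L_1 R - (R L_1 - L_1 R) *)
Definition mRE (X : 'M[A]_N) : tmx N 2 A :=
  RE X - (Rin *m fst1 X - fst1 X *m Rin).

End Over.

Inductive M_relator : falg F gens -> Prop :=
  MRel i j : M_relator (RE (\matrix_(x, y) fgen F (x, y)) i j).

Inductive L_relator : falg F gens -> Prop :=
  LRel i j : L_relator (mRE (\matrix_(x, y) fgen F (x, y)) i j).

Section Map.
Variables (A B : lalgType F) (f : {lrmorphism A -> B}).

Lemma map_Rin : map_mx f (Rin A) = Rin B.
Proof. by apply/matrixP=> i j; rewrite !mxE /= linearZ /= rmorph1. Qed.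

Lemma map_fst1 X : map_mx f (fst1 X) = fst1 (map_mx f X).
Proof.
apply/matrixP=> i j; rewrite !mxE; case: ifP => _; first by [].
exact: raddf0.
Qed.

Lemma map_RE X : map_mx f (RE X) = RE (map_mx f X).
Proof. by rewrite /RE map_mxB !map_mxM map_Rin map_fst1. Qed.

Lemma map_mRE X : map_mx f (mRE X) = mRE (map_mx f X).
Proof. by rewrite /mRE map_mxB map_RE map_mxB !map_mxM map_Rin map_fst1. Qed.

End Map.

Lemma RE1 (A : lalgType F) : RE (1%:M : 'M[A]_N) = 0.
Proof.
suff -> : RE (1%:M : 'M[A]_N) = Rin A *m Rin A - Rin A *m Rin A by rewrite subrr.
rewrite /RE; suff -> : fst1 (1%:M : 'M[A]_N) = 1%:M by rewrite !mulmx1 mul1mx.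
apply/matrixP=> a b; rewrite !mxE -(inj_eq enum_val_inj).
case: ifPn => [/forallP H|H].
  congr (_%:R); congr (nat_of_bool _).
  apply/eqP/eqP=> [E|-> //]; apply/ffunP=> l.
  by have [-> //|n] := eqVneq l ord0; apply/eqP; move: (H l); rewrite n.
by case: eqP H => // ->; case/negP; apply/forallP=> l; rewrite eqxx implybT.
Qed.

Lemma mRE0 (A : lalgType F) : mRE (0 : 'M[A]_N) = 0.
Proof.
rewrite /mRE /RE; suff -> : fst1 (0 : 'M[A]_N) = 0.
  by rewrite !(mulmx0, mul0mx) !subrr.
by apply/matrixP=> a b; rewrite !mxE; case: ifP => // _; rewrite mxE.
Qed.

(* M = 1 is a point of the M-relations, \hat L = 0 a point of the \hat L-relations. *)
Lemma M_aug r : M_relator r ->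
  feval (fun x : gens => (x.1 == x.2)%:R : F^o) r = 0.
Proof.
case=> i j; set g := fun _ => _; set X := \matrix_(_, _) _.
pose f : {lrmorphism falg F gens -> F^o} := feval (g : gens -> F^o).
transitivity ((map_mx f (RE X)) i j); first by rewrite [RHS]mxE.
rewrite map_RE; suff -> : map_mx f X = 1%:M by rewrite RE1 mxE.
by apply/matrixP=> x y; rewrite [LHS]mxE [X x y]mxE [f _]feval_gen [RHS]mxE.
Qed.

Lemma L_aug r : L_relator r -> feval (fun _ : gens => 0 : F^o) r = 0.
Proof.
case=> i j; set g := fun _ => _; set X := \matrix_(_, _) _.
pose f : {lrmorphism falg F gens -> F^o} := feval (g : gens -> F^o).
transitivity ((map_mx f (mRE X)) i j); first by rewrite [RHS]mxE.
rewrite map_mRE; suff -> : map_mx f X = 0 by rewrite mRE0 mxE.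
by apply/matrixP=> x y; rewrite [LHS]mxE [X x y]mxE [f _]feval_gen [RHS]mxE.
Qed.

Definition M_pres : presentation F gens := Presentation M_aug.
Definition L_pres : presentation F gens := Presentation L_aug.

(* M(R) and the modified reflection equation algebra \hat L(R) *)
Definition Malg := palg M_pres.
HB.instance Definition _ := GRing.Algebra.on Malg.
Definition Lalg := palg L_pres.
HB.instance Definition _ := GRing.Algebra.on Lalg.

Definition Mmx : 'M[Malg]_N := \matrix_(x, y) (pgen M_pres (x, y) : Malg).
Definition Lhat : 'M[Lalg]_N := \matrix_(x, y) (pgen L_pres (x, y) : Lalg).
Definition Lmx : 'M[Lalg]_N := 1%:M - in_alg Lalg (q - q^-1) *: Lhat.

Lemma RE_Mmx : RE Mmx = 0.
Proof.
apply/matrixP=> i j; pose X : 'M[falg F gens]_N := \matrix_(x, y) fgen F (x, y).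
have -> : Mmx = map_mx (@ppi F _ M_pres) X.
  by apply/matrixP=> x y; rewrite [RHS]mxE [X x y]mxE [LHS]mxE.
rewrite -map_RE [LHS]mxE [RHS]mxE.
exact: (@ppi_relator F _ M_pres _ (MRel i j)).
Qed.

Lemma mRE_Lhat : mRE Lhat = 0.
Proof.
apply/matrixP=> i j; pose X : 'M[falg F gens]_N := \matrix_(x, y) fgen F (x, y).
have -> : Lhat = map_mx (@ppi F _ L_pres) X.
  by apply/matrixP=> x y; rewrite [RHS]mxE [X x y]mxE [LHS]mxE.
rewrite -map_mRE [LHS]mxE [RHS]mxE.
exact: (@ppi_relator F _ L_pres _ (LRel i j)).
Qed.

(* the counit: \hat l_i^j |-> 0 *)
Definition eps : Lalg -> F^o := @palg_aug F _ L_pres.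
HB.instance Definition _ := GRing.LRMorphism.on eps.

(* Product of a matrix over M or L and a matrix over L or M, with entries
   multiplied by the tensor product. *)
Definition tmul (U V : lmodType F) n (X : 'M[U]_n) (Y : 'M[V]_n)
  : 'M[tensor U V]_n := \matrix_(i, j) \sum_k tens (X i k) (Y k j).

(* The permutation map is characterised by compatibility with units and products
   and by its value R L_1 R M_1 |-> M_1 R L_1 R^-1 on generators.  In the third
   clause sigma (a' (x) b) = sum x (x) y, sigma (a (x) x) = sum z (x) w and
   sigma (a a' (x) b) = sum z (x) w y; similarly for the fourth. *)
Definition permutation_map (sigma : {linear tensor Lalg Malg -> tensor Malg Lalg})
  : Prop :=
  [/\ forall b, sigma (tens 1 b) = tens b 1
    , forall a, sigma (tens a 1) = tens 1 a
    , forall a a' b, sigma (tens (a * a') b) =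
        tlift (fun x y => tlift (fun z w => tens z (w * y)) (sigma (tens a x)))
              (sigma (tens a' b))
    , forall a b b', sigma (tens a (b * b')) =
        tlift (fun x y => tlift (fun z w => tens (x * z) w) (sigma (tens y b')))
              (sigma (tens a b))
    & forall i j,
        sigma (tmul (Rin Lalg *m fst1 Lmx *m Rin Lalg) (fst1 Mmx) i j) =
        tmul (fst1 Mmx)
             (Rin Lalg *m fst1 Lmx *m map_mx (in_alg Lalg) (invmx R)) i j].

(* a |> b = (Id (x) eps) sigma (a (x) b) *)
Definition act (sigma : {linear tensor Lalg Malg -> tensor Malg Lalg})
    (a : Lalg) (b : Malg) : Malg :=
  tlift (fun x y => eps y *: x) (sigma (tens a b)).

(* M_{\bar i} on V^{(x) k}, i counted from 0 *)
Fixpoint Mbar k (i : nat) : tmx N k Malg :=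
  match i with
  | 0 => if insub 0 is Some l then leg1 l Mmx else 1%:M
  | i'.+1 => map_mx (in_alg Malg) (adj k R i') *m Mbar k i'
               *m map_mx (in_alg Malg) (invmx (adj k R i'))
  end.

(* Tr_{R(1..k)} (X M_1 M_{\bar 2} ... M_{\bar k}) *)
Definition schur (Psi : tmx N 2 F) k (X : tmx N k F) : Malg :=
  Rtrs (Cmx Psi)
    (map_mx (in_alg Malg) X *m \big[mulmx/1%:M]_(i < k) Mbar k i).

(* The first cut-and-join operator Tr_R \hat L. *)
Definition W1 (Psi : tmx N 2 F) : Lalg := Rtr (Cmx Psi) Lhat.

End MatrixRelations.

(* Tr_R \hat L = Tr_R (M D) for D = M^-1 \hat L, in any algebra in which M
   and \hat L live and M is invertible. *)
Lemma Rtr_MD (F : fieldType) (N : nat) (A : lalgType F) (C : 'M[F]_N)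
    (M Minv L : 'M[A]_N) :
  M *m Minv = 1%:M -> Rtr C L = Rtr C (M *m (Minv *m L)).
Proof. by move=> MK; rewrite mulmxA MK mul1mx. Qed.

Section HeckeAlgebra.
Variables (F : fieldType) (q : F) (k : nat).

Local Notation t := (@fgen F 'I_k.-1).

Inductive H_relator : falg F 'I_k.-1 -> Prop :=
| HBraid (i j : 'I_k.-1) : j = i.+1 :> nat ->
    H_relator (t i * t j * t i - t j * t i * t j)
| HComm (i j : 'I_k.-1) : (i.+1 < j)%N -> H_relator (t i * t j - t j * t i)
| HQuad (i : 'I_k.-1) :
    H_relator ((q%:A - t i) * (q^-1%:A + t i)).

Section Map.
Variables (A B : lalgType F) (f : {lrmorphism A -> B}).
Lemma map_braid x y : f x = f y -> f (x * y * x - y * x * y) = 0.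
Proof. by move=> E; rewrite rmorphB !rmorphM /= E subrr. Qed.
Lemma map_comm x y : f x = f y -> f (x * y - y * x) = 0.
Proof. by move=> E; rewrite rmorphB !rmorphM /= E subrr. Qed.
Lemma map_quad x : f x = q%:A -> f ((q%:A - x) * (q^-1%:A + x)) = 0.
Proof.
by move=> E; rewrite rmorphM rmorphB /= linearZ /= rmorph1 E subrr mul0r.
Qed.
End Map.

Lemma H_aug r : H_relator r -> feval (fun _ : 'I_k.-1 => q : F^o) r = 0.
Proof.
set g := fun _ => _.
pose f : {lrmorphism falg F 'I_k.-1 -> F^o} := feval (g : 'I_k.-1 -> F^o).
have E i : f (t i) = q by exact: feval_gen.
case=> [i j _|i j _|i]; [apply: (map_braid (f := f))|apply: (map_comm (f := f))|].
- by rewrite !E.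
- by rewrite !E.
- by apply: (map_quad (f := f)); rewrite E [RHS]mulr1.
Qed.

Definition H_pres : presentation F 'I_k.-1 := Presentation H_aug.

Definition hecke := palg H_pres.
HB.instance Definition _ := GRing.Algebra.on hecke.

Definition tau (i : nat) : hecke := if insub i is Some l then pgen H_pres l else 1.

(* Jucys-Murphy elements, numbered from 0 *)
Fixpoint JM (i : nat) : hecke :=
  if i is i'.+1 then tau i' * JM i' * tau i' else 1.

Definition primitive_idempotent (A : nzRingType) (e : A) : Prop :=
  [/\ e * e = e, e != 0
    & forall e1 e2 : A, e1 * e1 = e1 -> e2 * e2 = e2 ->
        e1 * e2 = 0 -> e2 * e1 = 0 -> e = e1 + e2 -> e1 = 0 \/ e2 = 0].

(* A table is given by the position (row, column), from 0, of each 0 <= i < k. *)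
Definition standard (lam : seq nat) (a : 'I_k -> nat * nat) : Prop :=
  [/\ injective a
    , forall x : nat * nat, (exists i, a i = x) <-> (x.2 < nth 0 lam x.1)%N
    , forall i j, (a i).1 = (a j).1 -> ((a i).2 < (a j).2)%N -> (i < j)%N
    & forall i j, (a i).2 = (a j).2 -> ((a i).1 < (a j).1)%N -> (i < j)%N].

Definition content (x : nat * nat) : int := x.2%:Z - x.1%:Z.

Definition young_idempotent (a : 'I_k -> nat * nat) (P : hecke) : Prop :=
  primitive_idempotent P /\
  forall i : 'I_k,
    JM i * P = (q ^ (2 * content (a i))) *: P /\
    P * JM i = (q ^ (2 * content (a i))) *: P.

Definition R_representation N (R : tmx N 2 F) (rho : {lrmorphism hecke -> tmx N k F})
  : Prop :=
  forall i : 'I_k.-1, rho (pgen H_pres i) = adj k R i.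

End HeckeAlgebra.

Definition is_partition N (lam : N.-tuple nat) (k : nat) : Prop :=
  sorted geq lam /\ sumn lam = k.

Definition qnum (F : fieldType) (q : F) (n : nat) : F :=
  (q ^+ n - q ^- n) / (q - q^-1).

(* Main.v *)
From HB Require Import structures.
Require Import Defs.
From mathcomp Require Import all_boot all_order all_algebra.
From mathcomp Require Import reals complex.
From mathcomp Require Import zify.

Set Implicit Arguments.
Unset Strict Implicit.
Unset Printing Implicit Defensive.

Import GRing.Theory.
Local Open Scope ring_scope.

(** Tracing the last factor against C sends R_k to 1, and, by the braid relation and
    skew-invertibility, it sends R_k^-1 X R_k to Tr_R X (x) 1 for X on the preceding factors.
    Pushing the permutation relation through M_1 ... M_k gives
    L_{k+1} |> M_1 ... M_k = J_{k+1}^-1 M_1 ... M_k, L_{k+1} being the conjugate of L_1 by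
    R_1 ... R_k.  Taking the trace of both sides over the last factor, the left-hand side
    becomes Tr_R L |> M_1 ... M_k; on the right, R^-1 = R - (q - 1/q) yields
    Tr_R J_{k+1}^-1 = Tr C - (q - 1/q) q^(-2N) (J_1^-1 + ... + J_k^-1).  Multiplying by the
    idempotent replaces each J_i^-1 by its eigenvalue.  The value Tr C = q^(-N) N_q comes from
    the antisymmetrizers: that of degree N + 1 vanishes because Lambda_R has degree N, its
    trace over the last factor is (Tr C - q^(-N) N_q) times a nonzero class in degree N. *)

(** * Operators on tensor powers *)

(** Passing $L$ through $M_1\cdots M_k$ is an induction that needs an arbitrary matrix $B$ to the
    right of the copies of $M$. Each crossing puts one $R^{-1}$ on each side of what has
    accumulated, which builds up $J_{k+1}^{-1}$, and the lower copy $R_k^{-1}\cdots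
    R_1^{-1}L_1R_1\cdots R_k$ comes out behind the $M$'s as the upper copy $R_k\cdots
    R_1L_1R_1^{-1}\cdots R_k^{-1}$ acting on $B$. At $B=1$ the counit makes this the identity.

    The number $\mathrm{Tr}\,C$ enters through the trace of $R_k^{-1}$ over the last factor,
    $1-(q-q^{-1})\mathrm{Tr}\,C=q^{-2N}$; this is the prefactor of the character. The summand
    $\mathrm{Tr}\,C$ of the traced $J_{k+1}^{-1}$ cancels against the one in
    $\mathrm{Tr}_RL=\mathrm{Tr}\,C-(q-q^{-1})\mathrm{Tr}_R\hat L$, and then $q-q^{-1}$ cancels too.

    To evaluate $\mathrm{Tr}\,C$, operators are read modulo the right ideal generated by the
    $R_i+q^{-1}$, that is, through what they do to the degree $k$ part of $\Lambda_R$. There every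
    $R_i$ is the number $-q^{-1}$, so a nonzero number congruent to 0 forces that part to vanish. *)

Section Kernels.
Variables (N : nat) (A : pzRingType).

Lemma tentE k (f : {ffun 'I_k -> 'I_N} -> {ffun 'I_k -> 'I_N} -> A) a b :
  tent (tmx_of f) a b = f a b.
Proof. by rewrite /tent mxE !enum_rankK. Qed.

Lemma tmxP k (X Y : tmx N k A) : (forall a b, tent X a b = tent Y a b) -> X = Y.
Proof.
by move=> H; apply/matrixP=> i j; have:= H (enum_val i) (enum_val j); rewrite /tent !enum_valK.
Qed.

Lemma tent1 k a b : tent (1%:M : tmx N k A) a b = (a == b)%:R.
Proof. by rewrite /tent mxE (inj_eq enum_rank_inj). Qed.

Lemma tentM k (X Y : tmx N k A) a c :
  tent (X *m Y) a c = \sum_b tent X a b * tent Y b c.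
Proof.
rewrite /tent mxE (reindex enum_rank) //=.
by exists enum_val => x _; rewrite ?enum_rankK ?enum_valK.
Qed.

Lemma slot_subproof m k i (h : (i + m <= k)%N) (l : 'I_m) : (i + l < k)%N.
Proof. by apply: leq_trans h; rewrite ltn_add2l. Qed.

Definition slot m k i (h : (i + m <= k)%N) (l : 'I_m) : 'I_k :=
  Ordinal (slot_subproof h l).

Lemma slot_inj m k i (h : (i + m <= k)%N) : injective (slot h).
Proof. by move=> x y [] /addnI /val_inj. Qed.

(** Placing by a function rather than a tuple makes placements compose, so that identities between
    placed operators reduce to equalities of index maps. *)
Definition legsf k m (f : 'I_m -> 'I_k) (X : tmx N m A) : tmx N k A :=
  tmx_of (fun a b =>
    if [forall l, (l \notin codom f) ==> (a l == b l)]
    then tent X [ffun l => a (f l)] [ffun l => b (f l)] else 0).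

Lemma eq_legsf k m (f g : 'I_m -> 'I_k) X : f =1 g -> legsf f X = legsf g X.
Proof.
move=> fg; apply: tmxP => a b; rewrite !tentE.
rewrite (_ : codom f = codom g); last by rewrite /codom /image_mem (eq_map fg).
by congr (if _ then tent X _ _ else 0); apply/ffunP=> l; rewrite !ffunE fg.
Qed.

Lemma legsfE k m (s : m.-tuple 'I_k) (X : tmx N m A) : legs s X = legsf (tnth s) X.
Proof.
apply: tmxP => a b; rewrite !tentE; congr (if _ then _ else _).
apply: eq_forallb => l; congr (~~ _ ==> _).
by apply/idP/codomP=> [/tnthP [i ->]|[i ->]]; [exists i | exact: mem_tnth].
Qed.

Lemma legsf1 k m (f : 'I_m -> 'I_k) : legsf f 1%:M = 1%:M.
Proof.
apply: tmxP => a b; rewrite tentE !tent1.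
case: ifPn => [/forallP H|H]; last first.
  by case: eqP H => // ->; case/negP; apply/forallP=> l; rewrite eqxx implybT.
congr (_%:R); congr nat_of_bool; apply/eqP/eqP=> [E|-> //].
apply/ffunP=> l; case cd: (l \in codom f); last by apply/eqP; move: (H l); rewrite cd.
by case/codomP: cd => i ->; move/ffunP/(_ i): E; rewrite !ffunE.
Qed.

Lemma legsfB k m (f : 'I_m -> 'I_k) X Y : legsf f (X - Y) = legsf f X - legsf f Y.
Proof.
have tB p (Z W : tmx N p A) a b : tent (Z - W) a b = tent Z a b - tent W a b.
  by rewrite /tent !mxE.
apply: tmxP => a b; rewrite tB !tentE tB.
by case: ifP => _; rewrite ?subr0.
Qed.

Lemma legsf_comp k m p (f : 'I_m -> 'I_k) (g : 'I_p -> 'I_m) X :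
  injective f -> legsf f (legsf g X) = legsf (f \o g) X.
Proof.
move=> fI; apply: tmxP => a b; rewrite !tentE.
have E (a' : {ffun 'I_k -> 'I_N}) :
    [ffun l => [ffun l => a' (f l)] (g l)] = [ffun l => a' ((f \o g) l)].
  by apply/ffunP=> l; rewrite !ffunE.
rewrite !E; case: ifPn => [/forallP H1|/forallPn [l]]; last first.
  rewrite negb_imply => /andP [lf ab]; case: ifPn => // /forallP /(_ l).
  by rewrite (negPf ab) implybF negbK => /codomP [i Ei]; rewrite Ei /= codom_f in lf.
congr (if _ then _ else _); apply/idP/idP => /forallP H; apply/forallP => l.
  apply/implyP => lfg; case lf: (l \in codom f); last by move: (H1 l); rewrite lf.
  case/codomP: lf lfg => l' -> lfg; have:= H l'; rewrite !ffunE.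
  by case: codomP => // -[i Ei]; rewrite /= Ei (codom_f (f \o g)) in lfg.
apply/implyP => lg; have:= H (f l); rewrite !ffunE => /implyP; apply.
by apply/codomP => -[i /fI Ei]; rewrite Ei codom_f in lg.
Qed.

(** On disjoint factors a single intermediate index survives in the product: it agrees with the
    column index on the factors of the left operator and with the row index elsewhere. The resulting
    formula is symmetric in the two operators. *)
Lemma legsf_comm k m p (f : 'I_m -> 'I_k) (g : 'I_p -> 'I_k) (X : tmx N m A) (Y : tmx N p A) :
  (forall i j, f i != g j) -> (forall i j i' j', GRing.comm (X i j) (Y i' j')) ->
  legsf f X *m legsf g Y = legsf g Y *m legsf f X.
Proof.
move=> fg XY; apply: tmxP => a c; rewrite !tentM.
have E m' p' (u : 'I_m' -> 'I_k) (v : 'I_p' -> 'I_k) Z W :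
   (forall i j, u i != v j) ->
   \sum_b tent (legsf u Z) a b * tent (legsf v W) b c =
   if [forall l, (l \notin codom u) && (l \notin codom v) ==> (a l == c l)] then
   tent Z [ffun l => a (u l)] [ffun l => c (u l)] *
   tent W [ffun l => a (v l)] [ffun l => c (v l)] else 0.
  move=> uv; have uvn l : l \in codom u -> l \notin codom v.
    by case/codomP=> i ->; apply/codomP=> -[j E]; move: (uv i j); rewrite E eqxx.
  pose b0 := [ffun l => if l \in codom u then c l else a l].
  rewrite (bigD1 b0) //= big1 ?addr0 => [|b bn]; last first.
    rewrite !tentE; case: ifPn => [/forallP H1|_]; last by rewrite mul0r.
    case: ifPn => [/forallP H2|_]; last by rewrite mulr0.
    case/eqP: bn; apply/ffunP=> l; rewrite ffunE; case: ifP => lu.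
      by apply/eqP; move: (H2 l); rewrite uvn.
    by apply/esym/eqP; move: (H1 l); rewrite lu.
  rewrite !tentE.
  have -> : [forall l, (l \notin codom u) ==> (a l == b0 l)].
    by apply/forallP=> l; rewrite ffunE; case: ifP => //= _; rewrite eqxx.
  rewrite (_ : [forall l, (l \notin codom v) ==> (b0 l == c l)] =
    [forall l, (l \notin codom u) && (l \notin codom v) ==> (a l == c l)]); last first.
    by apply: eq_forallb => l; rewrite ffunE; case: ifP; rewrite ?eqxx ?implybT.
  case: ifP => _; last by rewrite mulr0.
  congr (tent Z _ _ * tent W _ _); apply/ffunP=> l; rewrite !ffunE ?codom_f //.
  by case: ifP => // /uvn; rewrite codom_f.
rewrite !E // => [|i j]; last by rewrite eq_sym.
rewrite [in RHS](eq_forallb (P2 := fun l => (l \notin codom f) && (l \notin codom g) ==> (a l == c l))).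
  by case: ifP => // _; apply: XY.
by move=> l /=; rewrite andbC.
Qed.

End Kernels.

(** * Matrix products along a pairing of two rings *)

Section BilinearProduct.
Variables (N : nat) (A B D : pzRingType) (h : A -> B -> D).
Hypothesis h0l : forall b, h 0 b = 0.
Hypothesis h0r : forall a, h a 0 = 0.

(** Instances are the ordinary product, the action of a matrix over $\mathcal L(R)$ on a matrix over
    $\mathcal M(R)$, and both sides of the permutation relation applied to a further element. *)
Definition bmul n (X : 'M[A]_n) (Y : 'M[B]_n) : 'M[D]_n :=
  \matrix_(i, j) \sum_k h (X i k) (Y k j).

Lemma tent_bmul k (X : tmx N k A) (Y : tmx N k B) a c :
  tent (bmul X Y : tmx N k D) a c = \sum_b h (tent X a b) (tent Y b c).
Proof.
rewrite /tent mxE (reindex enum_rank) //=.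
by exists enum_val => x _; rewrite ?enum_rankK ?enum_valK.
Qed.

(** A contributing intermediate index agrees with the row index off the image of [f], so it is
    [ext b'] for an index [b'] of the small tensor power; [pick] inverts [f] on its image. *)
Lemma legsf_bmul k m (f : 'I_m -> 'I_k) (X : tmx N m A) (Y : tmx N m B) :
  injective f -> legsf f (bmul X Y) = bmul (legsf f X) (legsf f Y).
Proof.
move=> fI; apply: tmxP => a c; rewrite !tentE [RHS]tent_bmul tent_bmul.
under [RHS]eq_bigr do rewrite !tentE.
pose ext (b' : {ffun 'I_m -> 'I_N}) :=
  [ffun l => if [pick i | f i == l] is Some i then b' i else a l].
have extf b' i : ext b' (f i) = b' i.
  rewrite ffunE; case: pickP => [j /eqP/fI -> //|/(_ i)]; by rewrite eqxx.
have extn b' l : l \notin codom f -> ext b' l = a l.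
  by move=> lf; rewrite ffunE; case: pickP => // j /eqP E; rewrite -E codom_f in lf.
rewrite [RHS](bigID (fun b : {ffun 'I_k -> 'I_N} => [forall l, (l \notin codom f) ==> (a l == b l)])) /=.
rewrite [X in _ + X]big1 ?addr0 => [|b /negPf -> //].
rewrite (reindex_omap ext (fun b : {ffun 'I_k -> 'I_N} => Some [ffun l => b (f l)])) /=; last first.
  move=> b /forallP H; congr Some; apply/ffunP=> l.
  case cd: (l \in codom f); last by rewrite extn ?cd //; apply/eqP; move: (H l); rewrite cd.
  by case/codomP: cd => i ->; rewrite extf ffunE.
have E b' : [forall l, (l \notin codom f) ==> (a l == ext b' l)].
  by apply/forallP=> l; apply/implyP=> lf; rewrite extn.
have E2 b' : [ffun l => ext b' (f l)] = b' by apply/ffunP=> l; rewrite ffunE extf.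
rewrite [RHS](eq_bigl predT) => [|b']; last by rewrite E E2 eqxx.
rewrite [in RHS](eq_bigr (fun b' => if [forall l, (l \notin codom f) ==> (a l == c l)]
   then h (tent X [ffun l => a (f l)] b') (tent Y b' [ffun l => c (f l)]) else 0)).
  by case: ifP => // _; rewrite big1.
move=> b' _; rewrite E E2 (_ : [forall l, (l \notin codom f) ==> (ext b' l == c l)] =
  [forall l, (l \notin codom f) ==> (a l == c l)]); first by case: ifP.
by apply: eq_forallb => l; case: (boolP (_ \in _)) => //= lf; rewrite extn.
Qed.

End BilinearProduct.

Lemma mulmx_bmul (A : pzRingType) n (X Y : 'M[A]_n) : X *m Y = bmul *%R X Y.
Proof. by apply/matrixP=> i j; rewrite !mxE. Qed.

Lemma legsfM N (A : pzRingType) k m (f : 'I_m -> 'I_k) (X Y : tmx N m A) :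
  injective f -> legsf f (X *m Y) = legsf f X *m legsf f Y.
Proof.
by move=> fI; rewrite !mulmx_bmul legsf_bmul // => x; rewrite ?mul0r ?mulr0.
Qed.

(** * The last tensor factor and the weighted trace over it *)

Section LastFactor.
Variables (N : nat) (A : pzRingType).
Local Notation ins := (insert ord_max).

Lemma tentB k (X Y : tmx N k A) a b : tent (X - Y) a b = tent X a b - tent Y a b.
Proof. by rewrite /tent !mxE. Qed.

Lemma tentD k (X Y : tmx N k A) a b : tent (X + Y) a b = tent X a b + tent Y a b.
Proof. by rewrite /tent !mxE. Qed.

Lemma tentZ k c (X : tmx N k A) a b : tent (c *: X) a b = c * tent X a b.
Proof. by rewrite /tent !mxE. Qed.

Lemma ins_max k (x : 'I_N) (a : {ffun 'I_k -> 'I_N}) : ins x a ord_max = x.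
Proof. by rewrite ffunE unlift_none. Qed.

Lemma ins_widen k (x : 'I_N) (a : {ffun 'I_k -> 'I_N}) l :
  ins x a (widen_ord (leqnSn k) l) = a l.
Proof.
rewrite ffunE (_ : widen_ord _ l = lift ord_max l) ?liftK //.
by apply: val_inj; rewrite /= /bump leqNgt ltn_ord.
Qed.

Lemma ord_max_or_widen k (l : 'I_k.+1) :
  l = ord_max \/ exists l', l = widen_ord (leqnSn k) l'.
Proof.
have [lk|kl] := ltnP l k; [right|left]; last first.
  by apply: val_inj; apply/eqP; rewrite eqn_leq kl -ltnS ltn_ord.
by exists (Ordinal lk); apply: val_inj.
Qed.

Lemma ins_inj k (x y : 'I_N) (a b : {ffun 'I_k -> 'I_N}) :
  (ins x a == ins y b) = (x == y) && (a == b).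
Proof.
apply/eqP/andP=> [E|[/eqP-> /eqP->] //]; split; apply/eqP.
  by rewrite -(ins_max x a) E ins_max.
by apply/ffunP=> l; rewrite -(ins_widen x a) E ins_widen.
Qed.

Lemma ins_surj k (c : {ffun 'I_k.+1 -> 'I_N}) :
  c = ins (c ord_max) [ffun l => c (widen_ord (leqnSn k) l)].
Proof.
apply/ffunP=> l; case: (ord_max_or_widen l) => [->|[l' ->]].
  by rewrite ins_max.
by rewrite ins_widen ffunE.
Qed.

Lemma sum_ins k (V : nmodType) (G : {ffun 'I_k.+1 -> 'I_N} -> V) :
  \sum_c G c = \sum_x \sum_a G (ins x a).
Proof.
rewrite pair_bigA /= (reindex (fun p : 'I_N * {ffun 'I_k -> 'I_N} => ins p.1 p.2)) //.
exists (fun c : {ffun 'I_k.+1 -> 'I_N} => (c ord_max, [ffun l => c (widen_ord (leqnSn k) l)])) => [[x a]|c] _ /=.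
  by congr (_, _); rewrite ?ins_max //; apply/ffunP=> l; rewrite ffunE ins_widen.
by rewrite -ins_surj.
Qed.

Definition emb k (X : tmx N k A) : tmx N k.+1 A := legsf (widen_ord (leqnSn k)) X.

Lemma widen_inj k : injective (widen_ord (leqnSn k)).
Proof. by move=> x y [] /val_inj. Qed.

Lemma tent_emb k (X : tmx N k A) x y a b :
  tent (emb X) (ins x a) (ins y b) = if x == y then tent X a b else 0.
Proof.
rewrite tentE (_ : [forall l, _] = (x == y)).
  by congr (if _ then tent X _ _ else _); apply/ffunP=> l; rewrite ffunE ins_widen.
apply/forallP/eqP=> [/(_ ord_max)|-> l].
  rewrite !ins_max; case: codomP => [[i /(congr1 val) /= E]|_ /eqP //].
  by move: (ltn_ord i); rewrite -E ltnn.
case: (ord_max_or_widen l) => [->|[l' ->]]; first by rewrite !ins_max eqxx implybT.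
by rewrite codom_f.
Qed.

Lemma embM k (X Y : tmx N k A) : emb (X *m Y) = emb X *m emb Y.
Proof. exact/legsfM/widen_inj. Qed.

Lemma embB k (X Y : tmx N k A) : emb (X - Y) = emb X - emb Y.
Proof. exact: legsfB. Qed.

Lemma emb0 k : emb (0 : tmx N k A) = 0.
Proof. by rewrite -(subrr 0) embB subrr. Qed.

Lemma embD k (X Y : tmx N k A) : emb (X + Y) = emb X + emb Y.
Proof. by rewrite -[Y in LHS]opprK -[- Y]add0r !embB emb0 sub0r opprK. Qed.

Lemma emb1 k : emb (1%:M : tmx N k A) = 1%:M.
Proof. exact: legsf1. Qed.

Lemma embZ k c (X : tmx N k A) : emb (c *: X) = c *: emb X.
Proof.
apply: tmxP => a b; rewrite (ins_surj a) (ins_surj b) tentZ !tent_emb tentZ.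
by case: ifP => //; rewrite mulr0.
Qed.

Lemma emb_scalar k c : emb (c%:M : tmx N k A) = c%:M.
Proof. by rewrite -scalemx1 embZ emb1 scalemx1. Qed.

Lemma leg1E k (l : 'I_k) (X : 'M[A]_N) :
  leg1 l X = legsf (fun _ : 'I_1 => l) (leg1 ord0 X).
Proof.
apply: tmxP => a b; rewrite !tentE !ffunE.
rewrite (_ : [forall l0 : 'I_1, _] = true).
  congr (if _ then _ else _); apply: eq_forallb => l0; congr (~~ _ ==> _).
  by apply/eqP/codomP=> [->|[? ->] //]; exists ord0.
by apply/forallP=> i; rewrite ord1.
Qed.

Lemma leg11 k (l : 'I_k) : leg1 l (1%:M : 'M[A]_N) = 1%:M.
Proof.
rewrite leg1E (_ : leg1 ord0 1%:M = 1%:M) ?legsf1 //.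
apply: tmxP => a b; rewrite tentE tent1 mxE ifT.
  congr (_%:R); congr nat_of_bool; apply/eqP/eqP=> [E|-> //].
  by apply/ffunP=> i; rewrite ord1.
by apply/forallP=> i; rewrite ord1.
Qed.

Lemma emb_leg1 k (l : 'I_k) (X : 'M[A]_N) :
  emb (leg1 l X) = leg1 (widen_ord (leqnSn k) l) X.
Proof.
rewrite [RHS]leg1E [leg1 l X]leg1E /emb legsf_comp; last exact: widen_inj.
exact: eq_legsf.
Qed.

Lemma adjE k (X : tmx N 2 A) i (h : (i + 2 <= k)%N) : adj k X i = legsf (slot h) X.
Proof.
rewrite /adj; have h1 : (i.+1 < k)%N by rewrite -addn2.
rewrite (insubT (fun x => x < k)%N (ltnW h1)) (insubT (fun x => x < k)%N h1) legsfE.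
apply: eq_legsf => l; apply: val_inj; case: l => -[|[|//]] hl.
  by rewrite (tnth_nth (Ordinal h1)) /= addn0.
by rewrite (tnth_nth (Ordinal h1)) /= addn1.
Qed.

Lemma adj_out k (X : tmx N 2 A) i : (k <= i.+1)%N -> adj k X i = 1%:M.
Proof.
move=> ki; rewrite /adj; case: insubP => // l _ _.
by case: insubP => // l'; rewrite ltnNge ki.
Qed.

Lemma adjM k (X Y : tmx N 2 A) i : adj k (X *m Y) i = adj k X i *m adj k Y i.
Proof.
have [ki|ik] := leqP k i.+1; first by rewrite !adj_out // mulmx1.
by rewrite -addn2 in ik; rewrite !adjE legsfM //; exact: slot_inj.
Qed.

Lemma adj_id k i : adj k (1%:M : tmx N 2 A) i = 1%:M.
Proof.
have [ki|ik] := leqP k i.+1; first by rewrite adj_out.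
by rewrite -addn2 in ik; rewrite adjE legsf1.
Qed.

Lemma emb_adj k (X : tmx N 2 A) i : (i.+1 < k)%N -> emb (adj k X i) = adj k.+1 X i.
Proof.
rewrite -addn2 => h; have h' := leqW h; rewrite !adjE /emb legsf_comp; last exact: widen_inj.
by apply: eq_legsf => l; apply: val_inj.
Qed.

Lemma adj_comm k (X Y : tmx N 2 A) i j : (i.+1 < j)%N ->
  (forall i j i' j', GRing.comm (X i j) (Y i' j')) ->
  adj k X i *m adj k Y j = adj k Y j *m adj k X i.
Proof.
move=> ij XY; have [kj|jk] := leqP k j.+1.
  by rewrite [adj k Y j]adj_out // mul1mx mulmx1.
have ik : (i.+1 < k)%N := ltn_trans ij (ltnW jk).
rewrite -addn2 in ik; rewrite -addn2 in jk; rewrite !adjE.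
apply: legsf_comm XY => -[l hl] [l' hl']; rewrite -val_eqE /= neq_ltn.
by rewrite (leq_trans (_ : i + l < j)%N) ?leq_addr // (leq_trans _ ij) // ltnS -addn1 leq_add2l -ltnS.
Qed.

Lemma adj_leg1_comm k (h : (0 < k)%N) (X : tmx N 2 A) (Y : 'M[A]_N) i : (0 < i)%N ->
  (forall i j i' j', GRing.comm (X i j) (Y i' j')) ->
  adj k X i *m leg1 (Ordinal h) Y = leg1 (Ordinal h) Y *m adj k X i.
Proof.
move=> i0 XY; have [ki|ik] := leqP k i.+1; first by rewrite adj_out // mul1mx mulmx1.
rewrite -addn2 in ik; rewrite adjE leg1E; apply: legsf_comm => [l l'|? ? ? ?].
  by rewrite -val_eqE /= -lt0n addn_gt0 i0.
by rewrite mxE; case: ifP => _; [exact: XY | exact: commr0].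
Qed.

Lemma adj_braid k (X : tmx N 2 A) i : (i.+2 < k)%N ->
  adj 3 X 0 *m adj 3 X 1 *m adj 3 X 0 = adj 3 X 1 *m adj 3 X 0 *m adj 3 X 1 ->
  adj k X i *m adj k X i.+1 *m adj k X i = adj k X i.+1 *m adj k X i *m adj k X i.+1.
Proof.
rewrite -addn3 => h; have h0 : (i + 2 <= k)%N by apply: leq_trans h; rewrite leq_add2l.
have h1 : (i.+1 + 2 <= k)%N by rewrite addSnnS.
have E0 : adj k X i = legsf (slot h) (adj 3 X 0).
  rewrite (adjE _ h0) (@adjE 3 _ 0 isT) legsf_comp; last exact: slot_inj.
  by apply: eq_legsf => l; apply: val_inj.
have E1 : adj k X i.+1 = legsf (slot h) (adj 3 X 1).
  rewrite (adjE _ h1) (@adjE 3 _ 1 isT) legsf_comp; last exact: slot_inj.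
  by apply: eq_legsf => l; apply: val_inj; rewrite /= addSnnS.
by rewrite E0 E1 -!legsfM; try exact: slot_inj; move=> ->.
Qed.

(** One step of the recursion in [Rtrs], isolated because all identities are proved for the
    innermost trace. *)
Definition Tlast k (C : 'M[A]_N) (X : tmx N k.+1 A) : tmx N k A :=
  ptr ord_max (leg1 ord_max C *m X).

Lemma tent_leg1_max k (C : 'M[A]_N) x y (a b : {ffun 'I_k -> 'I_N}) :
  tent (leg1 ord_max C) (ins x a) (ins y b) = if a == b then C x y else 0.
Proof.
rewrite tentE !ins_max; congr (if _ then _ else _).
apply/forallP/eqP=> [H|-> l].
  apply/ffunP=> l; have:= H (widen_ord (leqnSn k) l); rewrite !ins_widen.
  by move=> /implyP H'; apply/eqP/H'; rewrite -val_eqE /= ltn_eqF.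
case: (ord_max_or_widen l) => [->|[l' ->]]; first by rewrite eqxx.
by rewrite !ins_widen eqxx implybT.
Qed.

Lemma tent_Tlast k C (X : tmx N k.+1 A) a b :
  tent (Tlast C X) a b = \sum_x \sum_y C x y * tent X (ins y a) (ins x b).
Proof.
rewrite tentE; apply: eq_bigr => x _; rewrite tentM sum_ins; apply: eq_bigr => y _.
rewrite (bigD1 a) //= big1 ?addr0 => [|c antisym_char]; rewrite tent_leg1_max ?eqxx //.
by rewrite eq_sym (negPf antisym_char) mul0r.
Qed.

Lemma TlastB k C (X Y : tmx N k.+1 A) : Tlast C (X - Y) = Tlast C X - Tlast C Y.
Proof.
apply: tmxP => a b; rewrite tentB !tent_Tlast -sumrB; apply: eq_bigr => x _.
by rewrite -sumrB; apply: eq_bigr => y _; rewrite tentB mulrBr.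
Qed.

Lemma TlastD k C (X Y : tmx N k.+1 A) : Tlast C (X + Y) = Tlast C X + Tlast C Y.
Proof.
apply: tmxP => a b; rewrite tentD !tent_Tlast -big_split; apply: eq_bigr => x _.
by rewrite -big_split; apply: eq_bigr => y _; rewrite tentD mulrDr.
Qed.

Lemma Tlast0 k C : Tlast C (0 : tmx N k.+1 A) = 0.
Proof. by rewrite -(subrr 0) TlastB subrr. Qed.

Lemma Tlast_leg1 k (C X : 'M[A]_N) : Tlast C (leg1 ord_max X) = (\tr (C *m X))%:M :> tmx N k A.
Proof.
apply: tmxP => a b; rewrite tent_Tlast -scalemx1 tentZ tent1.
have [->|ab] := eqVneq a b; last first.
  by rewrite mulr0 big1 // => x _; rewrite big1 // => y _; rewrite tent_leg1_max (negPf ab) mulr0.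
rewrite mulr1 /mxtrace; apply: eq_bigr => x _; rewrite mxE; apply: eq_bigr => y _.
by rewrite tent_leg1_max eqxx.
Qed.

Lemma Tlast1 k C : Tlast C (1%:M : tmx N k.+1 A) = (\tr C)%:M.
Proof. by rewrite -(leg11 ord_max) Tlast_leg1 mulmx1. Qed.

Lemma Tlast_embr k C (X : tmx N k.+1 A) (Y : tmx N k A) :
  Tlast C (X *m emb Y) = Tlast C X *m Y.
Proof.
apply: tmxP => a b; rewrite tent_Tlast tentM.
under [RHS]eq_bigr do rewrite tent_Tlast mulr_suml.
rewrite [RHS]exchange_big; apply: eq_bigr => x _.
under [RHS]eq_bigr do rewrite mulr_suml.
rewrite [RHS]exchange_big; apply: eq_bigr => y _.
rewrite tentM sum_ins (bigD1 x) //= [X in _ + X]big1 ?addr0 => [|z zx].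
  by rewrite mulr_sumr; apply: eq_bigr => c _; rewrite tent_emb eqxx mulrA.
by rewrite big1 // => c _; rewrite tent_emb (negPf zx) mulr0.
Qed.

(** Here the entries of [X] have to cross those of [C], hence the centrality condition, which has no
    counterpart on the right-hand side in [Tlast_embr]. *)
Lemma Tlast_embl k (C : 'M[A]_N) (X : tmx N k A) (Y : tmx N k.+1 A) :
  (forall i j x, GRing.comm (C i j) x) -> Tlast C (emb X *m Y) = X *m Tlast C Y.
Proof.
move=> cC; apply: tmxP => a b; rewrite tent_Tlast tentM.
under [RHS]eq_bigr do rewrite tent_Tlast mulr_sumr.
rewrite [RHS]exchange_big; apply: eq_bigr => x _.
under [RHS]eq_bigr do rewrite mulr_sumr.
rewrite [RHS]exchange_big; apply: eq_bigr => y _.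
rewrite tentM sum_ins (bigD1 y) //= [X in _ + X]big1 ?addr0 => [|z zx].
  rewrite mulr_sumr; apply: eq_bigr => c _; rewrite tent_emb eqxx !mulrA.
  by rewrite (cC x y).
by rewrite big1 // => c _; rewrite tent_emb eq_sym (negPf zx) mul0r.
Qed.

End LastFactor.

(** * Consequences of skew-invertibility *)

Section TwoFactors.
Variables (N : nat).
Local Notation ins := (insert ord_max).

Definition pr (i j : 'I_N) : {ffun 'I_2 -> 'I_N} := [ffun l => if l == ord0 then i else j].

Lemma pr_ins i j : pr i j = ins j [ffun=> i].
Proof.
apply/ffunP=> l; case: (ord_max_or_widen l) => [->|[l' ->]].
  by rewrite ins_max ffunE.
by rewrite ins_widen !ffunE -val_eqE /= (ord1 l').
Qed.

Lemma sum_pr (V : nmodType) (G : {ffun 'I_2 -> 'I_N} -> V) :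
  \sum_c G c = \sum_i \sum_j G (pr i j).
Proof.
rewrite sum_ins exchange_big /= (reindex (fun i : 'I_N => [ffun _ : 'I_1 => i])) /=.
  by apply: eq_bigr => i _; apply: eq_bigr => j _; rewrite pr_ins.
exists (fun c : {ffun 'I_1 -> 'I_N} => c ord0) => [i|c] _; first by rewrite ffunE.
by apply/ffunP=> l; rewrite ffunE (ord1 l).
Qed.

Lemma insert_mid i j x : insert (inord 1 : 'I_3) x (pr i j) = ins j (pr i x).
Proof.
have E1 : (inord 1 : 'I_3) = widen_ord (leqnSn 2) ord_max.
  by apply: val_inj; rewrite /= inordK.
apply/ffunP=> l; rewrite ffunE; case: unliftP => [l' ->|->]; last first.
  by rewrite E1 ins_widen ffunE.
case: l' => -[|[|//]] hl.
  rewrite (_ : lift _ _ = widen_ord (leqnSn 2) ord0) ?ins_widen ?ffunE //.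
  by apply: val_inj; rewrite /= inordK.
rewrite (_ : lift _ _ = ord_max) ?ins_max ?ffunE //.
by apply: val_inj; rewrite /= inordK.
Qed.

Section Ring.
Variable A : pzRingType.

Lemma tent_adj_last k (X : tmx N 2 A) x y x' y' (a b : {ffun 'I_k -> 'I_N}) :
  tent (adj k.+2 X k) (ins y (ins x a)) (ins y' (ins x' b)) =
  if a == b then tent X (pr x y) (pr x' y') else 0.
Proof.
have h : (k + 2 <= k.+2)%N by rewrite addn2.
have E x0 y0 (c : {ffun 'I_k -> 'I_N}) :
    [ffun l => ins y0 (ins x0 c) (slot h l)] = pr x0 y0.
  apply/ffunP=> l; rewrite [LHS]ffunE [RHS]ffunE; case: l => -[|[|//]] hl.
    rewrite (_ : slot _ _ = widen_ord (leqnSn k.+1) ord_max); last first.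
      by apply: val_inj; rewrite /= addn0.
    by rewrite ins_widen ins_max.
  rewrite (_ : slot _ _ = ord_max) ?ins_max //.
  by apply: val_inj; rewrite /= addn1.
rewrite (adjE _ h) tentE !E; congr (if _ then _ else _).
apply/forallP/eqP=> [H|-> l].
  apply/ffunP=> l; have:= H (widen_ord (leqnSn _) (widen_ord (leqnSn k) l)).
  rewrite !ins_widen => /implyP H'; apply/eqP/H'.
  apply/codomP=> -[l' /(congr1 val) /= E'].
  by move: (ltn_ord l); rewrite E' ltnNge leq_addr.
case: (ord_max_or_widen l) => [->|[l' ->]].
  rewrite (_ : ord_max = slot h ord_max) ?codom_f //.
  by apply: val_inj; rewrite /= addn1.
rewrite !ins_widen; case: (ord_max_or_widen l') => [->|[l2 ->]].
  rewrite (_ : widen_ord _ ord_max = slot h ord0) ?codom_f //.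
  by apply: val_inj; rewrite /= addn0.
by rewrite !ins_widen eqxx implybT.
Qed.

Lemma tent_mul_adjr k (X : tmx N 2 A) (Y : tmx N k.+2 A) c x j (b : {ffun 'I_k -> 'I_N}) :
  tent (Y *m adj k.+2 X k) c (ins x (ins j b)) =
  \sum_z \sum_r tent Y c (ins z (ins r b)) * tent X (pr r z) (pr j x).
Proof.
rewrite tentM sum_ins; apply: eq_bigr => z _; rewrite sum_ins; apply: eq_bigr => r _.
rewrite (bigD1 b) //= big1 ?addr0 => [|b' bb']; rewrite tent_adj_last ?eqxx //.
by rewrite (negPf bb') mulr0.
Qed.

Lemma tent_mul_adjl k (X : tmx N 2 A) (Y : tmx N k.+2 A) c y i (a : {ffun 'I_k -> 'I_N}) :
  tent (adj k.+2 X k *m Y) (ins y (ins i a)) c =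
  \sum_z \sum_p tent X (pr i y) (pr p z) * tent Y (ins z (ins p a)) c.
Proof.
rewrite tentM sum_ins; apply: eq_bigr => z _; rewrite sum_ins; apply: eq_bigr => p _.
rewrite (bigD1 a) //= big1 ?addr0 => [|a' aa']; rewrite tent_adj_last ?eqxx //.
by rewrite eq_sym (negPf aa') mul0r.
Qed.

Lemma tent_conj k (X Y : tmx N 2 A) (Z : tmx N k.+1 A) x y i j (a b : {ffun 'I_k -> 'I_N}) :
  tent (adj k.+2 X k *m emb Z *m adj k.+2 Y k) (ins y (ins i a)) (ins x (ins j b)) =
  \sum_z \sum_r \sum_p
    tent X (pr i y) (pr p z) * tent Z (ins p a) (ins r b) * tent Y (pr r z) (pr j x).
Proof.
rewrite tent_mul_adjr; apply: eq_bigr => z _; apply: eq_bigr => r _.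
rewrite tent_mul_adjl (bigD1 z) //= [X in _ + X]big1 ?addr0 => [|z' zz'].
  by rewrite mulr_suml; apply: eq_bigr => p _; rewrite tent_emb eqxx.
by rewrite big1 // => p _; rewrite tent_emb (negPf zz') mulr0.
Qed.

Lemma adj2 (X : tmx N 2 A) : adj 2 X 0 = X.
Proof.
apply: tmxP => a b; rewrite (@adjE _ _ 2 _ 0 isT) tentE ifT.
  by congr (tent X _ _); apply/ffunP=> l; rewrite ffunE; congr (_ _); apply: val_inj.
apply/forallP=> l; rewrite (_ : l \in codom _) //.
by apply/codomP; exists l; apply: val_inj.
Qed.

End Ring.

Section SkewInverse.
Variables (F : fieldType) (R Psi : tmx N 2 F).

Lemma tent_ptr_mid (X Y : tmx N 2 F) i j k l :
  tent (ptr (inord 1 : 'I_3) (adj 3 X 0 *m adj 3 Y 1)) (pr i k) (pr j l) =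
  \sum_m \sum_n tent X (pr i m) (pr j n) * tent Y (pr n k) (pr m l).
Proof.
rewrite tentE; apply: eq_bigr => m _; rewrite !insert_mid tentM sum_ins.
rewrite (bigD1 k) //= [X in _ + X]big1 ?addr0 => [|k' kk']; last first.
  rewrite big1 // => c _; rewrite -(@emb_adj _ _ 2) // tent_emb eq_sym (negPf kk').
  by rewrite mul0r.
rewrite sum_pr (bigD1 j) //= [X in _ + X]big1 ?addr0 => [|j' jj']; last first.
  rewrite big1 // => n _; rewrite [X in _ * X](_ : _ = 0) ?mulr0 //.
  rewrite !pr_ins tent_adj_last ifF //; apply/negbTE; apply: contra jj' => /eqP/ffunP/(_ ord0).
  by rewrite !ffunE => ->.
apply: eq_bigr => n _; rewrite -(@emb_adj _ _ 2) // tent_emb eqxx adj2; congr (_ * _).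
by rewrite ![in LHS]pr_ins tent_adj_last eqxx.
Qed.

Hypothesis RPsi : skew_inverse R Psi.
Local Notation C := (Cmx Psi).

Lemma tent_flip i j k l : tent (flip N F) (pr i k) (pr j l) = ((i == l) && (k == j))%:R.
Proof. by rewrite tentE !ffunE. Qed.

Lemma skew_RPsi i j k l :
  \sum_m \sum_n tent R (pr i m) (pr j n) * tent Psi (pr n k) (pr m l) =
  ((i == l) && (k == j))%:R.
Proof. by rewrite -tent_ptr_mid RPsi.1 tent_flip. Qed.

Lemma skew_PsiR i j k l :
  \sum_m \sum_n tent Psi (pr i m) (pr j n) * tent R (pr n k) (pr m l) =
  ((i == l) && (k == j))%:R.
Proof. by rewrite -tent_ptr_mid RPsi.2 tent_flip. Qed.

Lemma CmxE i j : C i j = \sum_x tent Psi (pr i x) (pr j x).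
Proof. by rewrite mxE. Qed.

(** [C] is the trace of [Psi] over its second factor, so this is the first skew-inverse relation
    with its last pair of indices set equal and summed. *)
Lemma Tlast_adj k : Tlast C (adj k.+2 R k) = 1%:M.
Proof.
apply: tmxP => a b; rewrite (ins_surj a) (ins_surj b) tent1 ins_inj tent_Tlast.
set i := a ord_max; set j := b ord_max; set a' := [ffun l => a _]; set b' := [ffun l => b _].
under eq_bigr do under eq_bigr do rewrite tent_adj_last.
have [_|ab] := eqVneq a' b'; last first.
  by rewrite andbF big1 // => x _; rewrite big1 // => y _; rewrite mulr0.
rewrite andbT; transitivity (\sum_(z < N) ((i == z) && (z == j))%:R : F).
  under [RHS]eq_bigr do rewrite -skew_RPsi exchange_big.
  rewrite [RHS]exchange_big; apply: eq_bigr => x _ /=.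
  rewrite [RHS]exchange_big; apply: eq_bigr => y _; rewrite CmxE mulr_suml.
  by apply: eq_bigr => z _; rewrite mulrC.
rewrite (bigD1 i) //= eqxx /= big1 ?addr0 // => z zi.
by rewrite eq_sym (negPf zi).
Qed.

Lemma map_tent (A B : pzRingType) k (f : A -> B) (X : tmx N k A) a b :
  tent (map_mx f X : tmx N k B) a b = f (tent X a b).
Proof. by rewrite /tent mxE. Qed.

Section Conjugation.
Hypothesis braid :
  adj 3 R 0 *m adj 3 R 1 *m adj 3 R 0 = adj 3 R 1 *m adj 3 R 0 *m adj 3 R 1.
Variable S : tmx N 2 F.
Hypotheses (RS : R *m S = 1%:M) (SR : S *m R = 1%:M).

(** The braid relation rewrites the argument as $R_0R_1R_0^{-1}$; the outer factors do not touch the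
    traced factor and cancel once $R_1$ is traced to 1. *)
Let conj_emb : Tlast C (adj 3 S 1 *m adj 3 R 0 *m adj 3 R 1) = 1%:M.
Proof.
have -> : adj 3 S 1 *m adj 3 R 0 *m adj 3 R 1 = adj 3 R 0 *m (adj 3 R 1 *m adj 3 S 0).
  transitivity (adj 3 S 1 *m (adj 3 R 1 *m adj 3 R 0 *m adj 3 R 1) *m adj 3 S 0).
    rewrite -braid -!mulmxA; congr (_ *m (_ *m _)).
    by rewrite -adjM RS adj_id mulmx1.
  by rewrite !mulmxA -adjM SR adj_id mul1mx.
have cC (i j : 'I_N) (x : F) : GRing.comm (C i j) x by apply: mulrC.
rewrite -(@emb_adj _ _ 2 R) // -(@emb_adj _ _ 2 S) // Tlast_embl // Tlast_embr.
by rewrite Tlast_adj mul1mx -adjM RS adj_id.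
Qed.

(** The coefficient of $X_{p,r}$ in the $(i,j)$ entry of the trace of $R^{-1}XR$, the four indices
    referring to the last factor that remains. *)
Let K i j p r := \sum_x \sum_y \sum_z
  C x y * tent S (pr i y) (pr p z) * tent R (pr r z) (pr j x).

(** [conj_emb] in coordinates: it gives a linear system for [K] with coefficient matrix [R]. *)
Let sum_RK i j u v :
  \sum_p \sum_r tent R (pr u p) (pr v r) * K i j p r = ((i == j) && (u == v))%:R.
Proof.
have:= congr1 (fun X => tent X (pr u i) (pr v j)) conj_emb.
rewrite -(@emb_adj _ _ 2 R) // adj2 /= tent1 !pr_ins ins_inj.
rewrite (_ : (_ == [ffun=> v]) = (u == v)); last first.
  by apply/eqP/eqP=> [/ffunP/(_ ord0)|->]; rewrite ?ffunE.
move=> <-; rewrite tent_Tlast.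
under [RHS]eq_bigr do under eq_bigr do rewrite tent_conj mulr_sumr.
rewrite /K; under eq_bigr do under eq_bigr do rewrite mulr_sumr.
under eq_bigr do rewrite exchange_big.
rewrite exchange_big; apply: eq_bigr => x _ /=.
under eq_bigr do under eq_bigr do rewrite mulr_sumr.
under eq_bigr do rewrite exchange_big.
rewrite exchange_big; apply: eq_bigr => y _ /=.
under eq_bigr do under eq_bigr do rewrite mulr_sumr.
under eq_bigr do rewrite exchange_big.
rewrite exchange_big; apply: eq_bigr => z _ /=.
rewrite exchange_big mulr_sumr; apply: eq_bigr => r _.
rewrite mulr_sumr; apply: eq_bigr => p _.
by rewrite -!pr_ins !mulrA; congr (_ * _); rewrite -[LHS]mulrA mulrC.
Qed.

(** The other skew-inverse relation says that [Psi] inverts the system [sum_RK], and contracting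
    [Psi] with the Kronecker delta on its right-hand side gives [C]. *)
Let K_C i j s t : K i j t s = (i == j)%:R * C s t.
Proof.
transitivity (\sum_p \sum_r ((s == r) && (p == t))%:R * K i j p r).
  rewrite (bigD1 t) //= [X in _ + X]big1 ?addr0 => [|p pt]; last first.
    by rewrite big1 // => r _; rewrite (negPf pt) andbF mul0r.
  rewrite (bigD1 s) //= [X in _ + X]big1 ?addr0 => [|r rs].
    by rewrite !eqxx mul1r.
  by rewrite eq_sym (negPf rs) mul0r.
under eq_bigr do under eq_bigr do rewrite -skew_PsiR pair_bigA mulr_suml.
rewrite pair_bigA exchange_big /=.
transitivity (\sum_(vu : 'I_N * 'I_N)
    tent Psi (pr s vu.1) (pr t vu.2) * ((i == j) && (vu.2 == vu.1))%:R).
  apply: eq_bigr => vu _; rewrite -sum_RK pair_bigA mulr_sumr.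
  by apply: eq_bigr => pr _; rewrite mulrA.
rewrite -(pair_bigA _ (fun v u => tent Psi (pr s v) (pr t u) * ((i == j) && (u == v))%:R)) /=.
rewrite CmxE mulr_sumr; apply: eq_bigr => v _.
rewrite (bigD1 v) //= big1 ?addr0 => [|u uv]; first by rewrite eqxx andbT mulrC.
by rewrite (negPf uv) andbF mulr0.
Qed.

(** The coefficients [K] are numbers, so the computation made for $X=R$ determines the trace for
    every [X], also with noncommuting entries. *)
Lemma Tlast_conj (A : algType F) k (X : tmx N k.+1 A) :
  Tlast (map_mx (in_alg A) C) (adj k.+2 (map_mx (in_alg A) S) k *m emb X *m
    adj k.+2 (map_mx (in_alg A) R) k) =
  emb (Tlast (map_mx (in_alg A) C) X).
Proof.
apply: tmxP => a b; rewrite (ins_surj a) (ins_surj b) tent_emb tent_Tlast.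
set i := a ord_max; set j := b ord_max; set a' := [ffun l => a _]; set b' := [ffun l => b _].
transitivity (\sum_r \sum_p K i j p r *: tent X (ins p a') (ins r b')); last first.
  rewrite tent_Tlast; case: ifPn => [/eqP ->|ij].
    apply: eq_bigr => r _; apply: eq_bigr => p _.
    by rewrite K_C eqxx mul1r [X in _ = X * _]mxE in_algE mulr_algl.
  by rewrite big1 // => r _; rewrite big1 // => p _; rewrite K_C (negPf ij) mul0r scale0r.
under [RHS]eq_bigr do under eq_bigr do rewrite scaler_suml.
under [RHS]eq_bigr do rewrite exchange_big.
rewrite [RHS]exchange_big; apply: eq_bigr => x _ /=.
under [RHS]eq_bigr do under eq_bigr do rewrite scaler_suml.
under [RHS]eq_bigr do rewrite exchange_big.
rewrite [RHS]exchange_big; apply: eq_bigr => y _ /=.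
under [RHS]eq_bigr do under eq_bigr do rewrite scaler_suml.
under [RHS]eq_bigr do rewrite exchange_big.
rewrite [RHS]exchange_big tent_conj mulr_sumr; apply: eq_bigr => z _ /=.
rewrite mulr_sumr; apply: eq_bigr => r _; rewrite mulr_sumr; apply: eq_bigr => p _.
rewrite mxE !map_tent /= !mulr_algl mulr_algr -!scalerA; congr (_ *: _).
by rewrite !scalerA mulrC.
Qed.
End Conjugation.
End SkewInverse.
End TwoFactors.

Lemma legsfZ N (A : pzRingType) k m (f : 'I_m -> 'I_k) c (X : tmx N m A) :
  legsf f (c *: X) = c *: legsf f X.
Proof.
by apply: tmxP => a b; rewrite tentZ !tentE tentZ; case: ifP => //; rewrite mulr0.
Qed.

Lemma emb_emb_comm N (A : pzRingType) k (X : tmx N 2 A) (Y : tmx N k A) :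
  (forall i j i' j', GRing.comm (X i j) (Y i' j')) ->
  adj k.+2 X k *m emb (emb Y) = emb (emb Y) *m adj k.+2 X k.
Proof.
move=> XY; have h : (k + 2 <= k.+2)%N by rewrite addn2.
rewrite (adjE _ h) /emb legsf_comp; last exact: widen_inj.
apply: legsf_comm XY => l l'; rewrite -val_eqE /= neq_ltn orbC.
by rewrite (leq_trans (ltn_ord l')) ?leq_addr.
Qed.

(** * The trace of C *)

Section HeckeSymmetryTrace.
Variables (F : fieldType) (N : nat) (q : F) (R Psi : tmx N 2 F).
Hypotheses (gen_q : generic q) (hR : hecke_symmetry q R) (RPsi : skew_inverse R Psi).
Local Notation e := (- q^-1).
Local Notation nu := (q - q^-1).

Let q0 : q != 0. Proof. by case: gen_q. Qed.

Lemma hecke_sq : R *m R = 1%:M + nu *: R.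
Proof.
have:= hR.2; rewrite mulmxDr mul_mx_scalar mulmxBl mul_scalar_mx scalerBr scale_scalar_mx.
rewrite mulVf // addrA => /subr0_eq <-.
by rewrite scalerBl -!addrA; congr (_ + _); rewrite addrC.
Qed.

Lemma hecke_inv : R *m (R - nu%:M) = 1%:M.
Proof. by rewrite mulmxBr hecke_sq mul_mx_scalar addrK. Qed.

Lemma invmx_R : invmx R = R - nu%:M.
Proof.
have uR : R \in unitmx by case/mulmx1_unit: hecke_inv.
by rewrite -[LHS]mulmx1 -hecke_inv mulKmx.
Qed.

Lemma R_unit : R \in unitmx.
Proof. by case/mulmx1_unit: hecke_inv. Qed.

Lemma adj_shift k i c : (i.+1 < k)%N -> adj k (R - c%:M) i = adj k R i - c%:M.
Proof.
rewrite -addn2 => h; rewrite !(adjE _ h) legsfB; congr (_ - _).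
by rewrite -scalemx1 legsfZ legsf1 scalemx1.
Qed.

Lemma adj_sq k i : (i.+1 < k)%N -> adj k R i *m adj k R i = 1%:M + nu *: adj k R i.
Proof.
rewrite -addn2 => h; have I : injective (slot h) by apply: slot_inj.
rewrite !(adjE _ h) -legsfM // hecke_sq -[X in _ + X]opprK legsfB legsf1; congr (_ + _).
by rewrite -scaleNr legsfZ scaleNr opprK.
Qed.

(* [coset_sum k.+1] is the sum over minimal representatives of S_{k+1} / S_k, so that
   [antisym] is the unnormalized antisymmetrizer, the sum of (-1/q)^l(w) T_w. *)
Fixpoint coset_sum k : tmx N k F :=
  if k is k'.+1 then 1%:M + e *: (emb (coset_sum k') *m adj k'.+1 R k'.-1) else 0.

Fixpoint antisym k : tmx N k F :=
  if k is k'.+1 then coset_sum k'.+1 *m emb (antisym k') else 1%:M.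

(** By the Hecke condition [R] multiplies the image of $R+q^{-1}$ by $q$, and $-q^{-1}\cdot
    q=-1$. *)
Lemma adj_e_last k : e *: (adj k.+2 R k *m (adj k.+2 R k - e%:M)) = - (adj k.+2 R k - e%:M).
Proof.
rewrite mulmxBr adj_sq // mul_mx_scalar -addrA -scaleNr -scalerDl opprK subrK.
rewrite scalerDr scalerA mulNr mulVf // scaleN1r scalemx1 opprB.
by rewrite addrC addrC.
Qed.

Let braid3 k : adj k.+3 R k *m adj k.+3 R k.+1 *m adj k.+3 R k =
  adj k.+3 R k.+1 *m adj k.+3 R k *m adj k.+3 R k.+1.
Proof. by apply: adj_braid => //; case: hR. Qed.

(** The base case is the Hecke condition. For the step, [B] commutes with [z], and the braid
    relation gives $BA(B-e)=(A-e)BA$. The terms in $Z(B-e)$ cancel by [adj_e_last]; the remaining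
    one contains $Zz(A-e)$, which vanishes by induction. *)
Lemma coset_sum_annih k : coset_sum k.+2 *m emb (coset_sum k.+1) *m (adj k.+2 R k - e%:M) = 0.
Proof.
elim: k => [|k IH].
  rewrite /= emb0 mul0mx scaler0 addr0 !emb1 mul1mx mulmx1 mulmxDl mul1mx -scalemxAl.
  by rewrite adj_e_last addrN.
have:= congr1 (@emb _ _ _) IH; rewrite emb0 !embM embB emb_scalar emb_adj //.
set A := adj k.+3 R k; set B := adj k.+3 R k.+1 => {}IH.
have zB : B *m emb (emb (coset_sum k.+1)) = emb (emb (coset_sum k.+1)) *m B.
  by apply: emb_emb_comm => *; apply: mulrC.
have ZE : emb (coset_sum k.+2) = 1%:M + e *: (emb (emb (coset_sum k.+1)) *m A).
  by rewrite {1}[coset_sum k.+2]/= embD emb1 embZ embM emb_adj.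
set z := emb (emb (coset_sum k.+1)) in IH zB ZE; set Z := emb (coset_sum k.+2) in IH ZE *.
have -> : coset_sum k.+3 = 1%:M + e *: (Z *m B) by [].
set W := B - e%:M.
have BW : e *: (B *m W) = - W by apply: adj_e_last.
have BAW : B *m (A *m W) = (A - e%:M) *m (B *m A).
  rewrite !mulmxBr mulmxBl mul_mx_scalar mul_scalar_mx -scalemxAr !mulmxA.
  by rewrite -braid3.
have BZW : B *m (Z *m W) = B *m W + e *: (z *m ((A - e%:M) *m (B *m A))).
  by rewrite ZE mulmxDl mul1mx mulmxDr -scalemxAl -scalemxAr !mulmxA zB -!mulmxA BAW.
clearbody W Z. rewrite mulmxDl mul1mx mulmxDl -!scalemxAl -!mulmxA BZW mulmxDr scalerDr.
rewrite [e *: (Z *m (B *m W))]scalemxAr BW mulmxN addrA addrN add0r -scalemxAr.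
by rewrite (mulmxA z) (mulmxA Z) (mulmxA Z) IH mul0mx !scaler0.
Qed.

(** The last generator commutes with the antisymmetrizer two degrees below, and moving it across
    leaves the product of two coset sums of [coset_sum_annih]. Earlier generators are handled by the
    recursion. *)
Lemma antisym_annih k i : (i.+1 < k)%N -> antisym k *m (adj k R i - e%:M) = 0.
Proof.
elim: k i => // k IH i; rewrite ltnS leq_eqVlt => /predU1P [<-{k IH}|ik].
  rewrite [antisym _]/= embM -!mulmxA; set W := _ - _.
  have -> : emb (emb (antisym i)) *m W = W *m emb (emb (antisym i)).
    rewrite /W mulmxBl mulmxBr mul_mx_scalar mul_scalar_mx; congr (_ - _).
    by rewrite emb_emb_comm // => *; apply: mulrC.
  by rewrite !mulmxA coset_sum_annih mul0mx.
rewrite [antisym _]/= -mulmxA -(emb_adj R ik) -(@emb_scalar N F k e) -embB -embM IH //.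
by rewrite emb0 mulmx0.
Qed.

(** The last generator is traced to 1. The convention [coset_sum 0 = 0] lets the same formula hold
    in degree 1. *)
Lemma Tlast_coset_sum k : Tlast (Cmx Psi) (coset_sum k.+1) = (\tr (Cmx Psi))%:M + e *: coset_sum k.
Proof.
rewrite [coset_sum _]/= TlastD Tlast1; congr (_ + _); case: k => [|k].
  by rewrite emb0 mul0mx !scaler0 Tlast0.
rewrite scalemxAl -embZ Tlast_embl => [|i j x]; last exact: mulrC.
by rewrite Tlast_adj // mulmx1.
Qed.

Lemma Tlast_antisym k :
  Tlast (Cmx Psi) (antisym k.+1) = ((\tr (Cmx Psi))%:M + e *: coset_sum k) *m antisym k.
Proof. by rewrite [antisym _]/= Tlast_embr Tlast_coset_sum. Qed.

(* [X] is the scalar [c] modulo the degree k part of the ideal defining Lambda_R *)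
Definition modLambda k (X : tmx N k F) c :=
  exists Y : nat -> tmx N k F, X = c%:M + \sum_(i < k.-1) (adj k R i - e%:M) *m Y i.

Lemma modLambda_scalar k c : modLambda (c%:M : tmx N k F) c.
Proof. by exists (fun=> 0); rewrite big1 ?addr0 // => i _; rewrite mulmx0. Qed.

Lemma modLambda_add k (X Y : tmx N k F) c d :
  modLambda X c -> modLambda Y d -> modLambda (X + Y) (c + d).
Proof.
move=> [X' ->] [Y' ->]; exists (fun i => X' i + Y' i).
by rewrite addrACA raddfD -big_split; congr (_ + _); apply: eq_bigr => i _; rewrite mulmxDr.
Qed.

(** A right ideal suffices: with $X=c+x$ and $Y=d+y$ one has $XY=cd+cy+xY$. *)
Lemma modLambda_mul k (X Y : tmx N k F) c d :
  modLambda X c -> modLambda Y d -> modLambda (X *m Y) (c * d).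
Proof.
move=> [X' ->] [Y' EY]; exists (fun i => c *: Y' i + X' i *m Y).
rewrite mulmxDl mul_scalar_mx {1}EY scalerDr scale_scalar_mx -addrA; congr (_ + _).
rewrite scaler_sumr mulmx_suml -big_split; apply: eq_bigr => i _.
by rewrite mulmxDr -scalemxAr mulmxA.
Qed.

Lemma modLambda_emb k (X : tmx N k F) c : modLambda X c -> modLambda (emb X) c.
Proof.
move=> [X' ->]; exists (fun i => if (i < k.-1)%N then emb (X' i) else 0).
rewrite embD emb_scalar; congr (_ + _).
rewrite (big_morph _ (@embD _ _ _) (@emb0 _ _ _)).
case: k X X' => [|[|k]] _ X'; rewrite ?big_ord0 // [RHS]big_ord_recr /=.
  by rewrite !big_ord0 mulmx0 addr0.
rewrite ltnn mulmx0 addr0.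
apply: eq_bigr => i _; rewrite ltn_ord embM embB emb_scalar emb_adj //.
by rewrite ltnS; exact: (ltn_ord i).
Qed.

Lemma modLambda_adj k i : (i.+1 < k)%N -> modLambda (adj k R i) e.
Proof.
move=> ik; have ik' : (i < k.-1)%N by case: k ik.
exists (fun j => (i == j)%:R%:M).
rewrite (bigD1 (Ordinal ik')) //= big1 => [|j ji].
  by rewrite eqxx mulmx1 addr0 addrC subrK.
have -> : (i == j) = false.
  by apply/negbTE; apply: contra ji => /eqP ij; apply/eqP/val_inj.
by rewrite raddf0 mulmx0.
Qed.

(** The value of [coset_sum] under the character $\tau_i\mapsto -q^{-1}$ of the Hecke algebra,
    explicitly $1+q^{-2}+\dots+q^{-2(k-1)}$; [antisym_char] is likewise the value of [antisym]. *)
Fixpoint coset_char k : F := if k is k'.+1 then 1 + e * (coset_char k' * e) else 0.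
Fixpoint antisym_char k : F := if k is k'.+1 then coset_char k'.+1 * antisym_char k' else 1.

Lemma modLambda_scale k (X : tmx N k F) c d : modLambda X c -> modLambda (d *: X) (d * c).
Proof. by rewrite -mul_scalar_mx; apply: modLambda_mul; exact: modLambda_scalar. Qed.

Lemma modLambda_coset_sum k : modLambda (coset_sum k) (coset_char k).
Proof.
elim: k => [|k IH]; first by rewrite /= -(raddf0 (@scalar_mx F _)); exact: modLambda_scalar.
apply: modLambda_add; first exact: modLambda_scalar.
apply: modLambda_scale; case: k IH => [|k] IH.
  by rewrite /= emb0 !mul0mx mul0r -(raddf0 (@scalar_mx F _)); exact: modLambda_scalar.
by apply: modLambda_mul; [exact: modLambda_emb | exact: modLambda_adj].
Qed.

Lemma modLambda_antisym k : modLambda (antisym k) (antisym_char k).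
Proof.
elim: k => [|k IH]; first exact: modLambda_scalar.
by apply: modLambda_mul; [exact: modLambda_coset_sum | exact: modLambda_emb].
Qed.

Lemma coset_charE k : (1 - q^-1 ^+ 2) * coset_char k = 1 - q^-1 ^+ (2 * k).
Proof.
elim: k => [|k IH]; first by rewrite mulr0 muln0 expr0 subrr.
rewrite /= mulNr !mulrN opprK mulrDr mulr1.
rewrite (_ : _ * _ = q^-1 ^+ 2 * ((1 - q^-1 ^+ 2) * coset_char k)); last first.
  by rewrite [q^-1 * _]mulrCA [coset_char k * _]mulrC -expr2 mulrCA.
by rewrite IH mulrBr mulr1 -exprD mulnS addrA subrK.
Qed.

Lemma coset_char_neq0 k : coset_char k.+1 != 0.
Proof.
apply/eqP => E; have:= coset_charE k.+1; rewrite E mulr0 => /esym/eqP.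
rewrite subr_eq0 eq_sym exprVn invr_eq1; case: gen_q => _ _ _ /(_ (2 * k.+1)%N).
by rewrite mulnS add2n => /(_ isT) /negPf ->.
Qed.

Lemma antisym_char_neq0 k : antisym_char k != 0.
Proof. by elim: k => [|k IH]; rewrite ?oner_eq0 // mulf_neq0 ?coset_char_neq0. Qed.

Lemma nu_neq0 : nu != 0.
Proof.
case: gen_q => _ _ _ /(_ 2 isT); apply: contra => /eqP /subr0_eq E.
by rewrite expr2 {2}E mulfV.
Qed.

Lemma rank_Lambda k : (dim_Lambda q R k == 0%N) =
  row_full (\sum_(i < k.-1) (adj k R i - e%:M)^T)%MS.
Proof.
rewrite /dim_Lambda /row_full subn_eq0 eqn_leq rank_leq_col /=; congr (_ <= \rank _)%N.
by apply: eq_bigr => i _; rewrite raddfN opprK addrC.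
Qed.

(** The antisymmetrizer kills the image of every $q^{-1}+R_i$, and these images span the whole space
    when the degree $k$ part of $\Lambda_R$ is zero. *)
Lemma antisym_eq0 k : dim_Lambda q R k = 0%N -> antisym k = 0.
Proof.
move/eqP; rewrite rank_Lambda => full; apply: trmx_inj; rewrite trmx0 -[LHS]mul1mx.
apply/sub_kermxP; apply: submx_trans (submx_full _ full) _.
apply/sumsmx_subP => i _; apply/sub_kermxP; rewrite -trmx_mul antisym_annih ?trmx0 //.
by case: k i {full} => [|k] [i hi].
Qed.

(** Dividing by [c] writes the identity as a combination of the $R_i+q^{-1}$, whose images therefore
    fill the tensor power. *)
Lemma modLambda0 k c : modLambda (0 : tmx N k F) c -> c != 0 -> dim_Lambda q R k = 0%N.
Proof.
move=> [Y EY] c0; apply/eqP; rewrite rank_Lambda -sub1mx.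
have -> : 1%:M = (- c^-1) *: \sum_(i < k.-1) (Y i)^T *m (adj k R i - e%:M)^T.
  under eq_bigr do rewrite -trmx_mul.
  rewrite -raddf_sum /= (_ : \sum_i _ = - c%:M).
    by rewrite raddfN /= tr_scalar_mx scalerN scaleNr opprK scale_scalar_mx mulVf.
  by apply/eqP; rewrite -addr_eq0 addrC -EY.
apply: scalemx_sub; apply: summx_sub => i _; apply: submx_trans (submxMl _ _) _.
by apply: (sumsmx_sup i).
Qed.

(** The right-hand side is $q^{-1}(1+q^{-2}+\dots+q^{-2(N-1)})=q^{-N}N_q$. *)
Lemma trC_eq : even_of_rank q R N -> \tr (Cmx Psi) = - e * coset_char N.
Proof.
move=> [p [pm sp pE]]; apply/eqP; rewrite mulNr -addr_eq0; apply/negPn/negP => nz.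
have dN : dim_Lambda q R N = 1%N.
  by have:= pE N; rewrite -[N in p`_N]/(N.+1.-1) -sp -lead_coefE (monicP pm) => -[].
have dN1 : dim_Lambda q R N.+1 = 0%N.
  by have:= pE N.+1; rewrite nth_default ?sp // => -[].
have: modLambda (0 : tmx N N F) ((\tr (Cmx Psi) + e * coset_char N) * antisym_char N).
  rewrite -(Tlast0 _ (Cmx Psi)) -(antisym_eq0 dN1) Tlast_antisym; apply: modLambda_mul (modLambda_antisym _).
  apply: modLambda_add; first exact: modLambda_scalar.
  by apply: modLambda_scale; exact: modLambda_coset_sum.
by move/modLambda0; rewrite dN mulf_neq0 ?antisym_char_neq0 // => /(_ isT).
Qed.

Lemma nu_trC : even_of_rank q R N -> 1 - nu * \tr (Cmx Psi) = q ^- (2 * N).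
Proof.
move=> /trC_eq ->; rewrite opprK mulrA mulrBl mulfV // -expr2 coset_charE opprB addrC subrK.
by rewrite exprVn.
Qed.

Lemma Tlast_adjV k : even_of_rank q R N ->
  Tlast (Cmx Psi) (adj k.+2 (invmx R) k) = (q ^- (2 * N))%:M.
Proof.
move=> ev; rewrite invmx_R adj_shift // TlastB Tlast_adj //.
rewrite -[nu%:M]mulmx1 -(emb_scalar N k.+1 nu) Tlast_embl => [|i j x]; last exact: mulrC.
by rewrite Tlast1 -scalar_mxM -raddfB nu_trC.
Qed.

End HeckeSymmetryTrace.

(** * The action of L(R) on M(R) *)

Section TensorProduct.
Variables (F : fieldType) (U V : lmodType F).

Lemma tens_linl v : linear (fun u : U => tens u v : tensor U V).
Proof.
move=> c u u'; rewrite -linearZ -raddfD; apply/eqP/lpi_eqP; apply: span_gen.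
by rewrite opprD addrA; exact: BilinL.
Qed.

Lemma tens_linr u : linear (fun v : V => tens u v : tensor U V).
Proof.
move=> c v v'; rewrite -linearZ -raddfD; apply/eqP/lpi_eqP; apply: span_gen.
by rewrite opprD addrA; exact: BilinR.
Qed.

Lemma linear_tlift (W W' : lmodType F) (h : W -> W') (f : U -> V -> W) x :
  linear h -> h (tlift f x) = tlift (fun u v => h (f u v)) x.
Proof.
move=> hl; pose h' : {linear W -> W'} := HB.pack h (GRing.isLinear.Build _ _ _ _ h hl).
by rewrite -[h]/(h' : W -> W') linear_sum; apply: eq_bigr => p _; rewrite linearZ.
Qed.

Lemma eq_tlift (W : lmodType F) (f g : U -> V -> W) x : f =2 g -> tlift f x = tlift g x.
Proof. by move=> fg; apply: eq_bigr => p _; rewrite fg. Qed.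

End TensorProduct.

Section Action.
Variables (F : fieldType) (LA MA : algType F) (ep : {lrmorphism LA -> F^o}).
Variable sigma : {linear tensor LA MA -> tensor MA LA}.
Hypothesis sigma1l : forall b, sigma (tens 1 b) = tens b 1.
Hypothesis sigma1r : forall a, sigma (tens a 1) = tens 1 a.
Hypothesis sigmaM : forall a b b', sigma (tens a (b * b')) =
  tlift (fun x y => tlift (fun z w => tens (x * z) w) (sigma (tens y b'))) (sigma (tens a b)).

Definition pair_eps (x : MA) (y : LA) : MA := (ep y : F) *: x.
Definition acts (a : LA) (b : MA) : MA := tlift pair_eps (sigma (tens a b)).

Let eps_linl y : linear (pair_eps^~ y).
Proof. by move=> c x x'; rewrite /pair_eps scalerDr !scalerA mulrC. Qed.

Let eps_linr x : linear (pair_eps x).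
Proof. by move=> c y y'; rewrite /pair_eps linearP scalerDl scalerA. Qed.

Lemma acts_linl b : linear (acts^~ b).
Proof. by move=> c a a'; rewrite /acts tens_linl linearP tlift_linear. Qed.

Lemma acts_linr a : linear (acts a).
Proof. by move=> c b b'; rewrite /acts tens_linr linearP tlift_linear. Qed.

Lemma acts1l b : acts 1 b = b.
Proof. by rewrite /acts sigma1l tlift_tens // /pair_eps rmorph1 scale1r. Qed.

Lemma acts1r a : acts a 1 = (ep a : F)%:A.
Proof. by rewrite /acts sigma1r tlift_tens. Qed.

(** Compatibility of the permutation map with products moves [a] past [b] first; the counit is then
    applied only after what is left of [a] has passed [b']. *)
Lemma actsM a b b' : acts a (b * b') = tlift (fun x y => x * acts y b') (sigma (tens a b)).
Proof.
rewrite /acts sigmaM linear_tlift; last exact: tlift_linear.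
apply: eq_tlift => x y; rewrite linear_tlift; last exact: tlift_linear.
rewrite [RHS](linear_tlift (h := fun u => x * u)); last first.
  by move=> c u u'; rewrite mulrDr scalerAr.
by apply: eq_tlift => z w; rewrite tlift_tens // /pair_eps scalerAr.
Qed.

(** Both sides of the relation for [sigma] are mapped by $x\otimes y\mapsto x\,(y\rhd b)$, so a
    relation between generators holds in front of any [b]. *)
Lemma acts_exchange n (X X' : 'M[LA]_n) (Y Y' : 'M[MA]_n) b i j :
  sigma (tmul X Y i j) = tmul Y' X' i j ->
  \sum_k acts (X i k) (Y k j * b) = \sum_k Y' i k * acts (X' k j) b.
Proof.
pose f (x : MA) (y : LA) := x * acts y b.
have fl y : linear (f^~ y) by move=> c u u'; rewrite /f mulrDl scalerAl.
have fr x : linear (f x) by move=> c u u'; rewrite /f acts_linl mulrDr scalerAr.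
pose g : {linear tensor MA LA -> MA} :=
  HB.pack (tlift f) (GRing.isLinear.Build _ _ _ _ (tlift f) (tlift_linear fl fr)).
rewrite !mxE => sg; transitivity (g (sigma (\sum_k tens (X i k) (Y k j)))).
  by rewrite !linear_sum; apply: eq_bigr => k _; rewrite actsM.
by rewrite sg linear_sum; apply: eq_bigr => k _; rewrite /= tlift_tens.
Qed.

End Action.

(** Lets ordered products of matrices be split at the last factor by the generic lemmas on iterated
    operations. *)
HB.instance Definition _ (A : pzRingType) n :=
  Monoid.isLaw.Build 'M[A]_n 1%:M mulmx (@mulmxA A n n n n) (@mul1mx A n n) (@mulmx1 A n n).

Lemma map_legsf N (A B : pzRingType) (f : {rmorphism A -> B}) k m (g : 'I_m -> 'I_k)
    (X : tmx N m A) : map_mx f (legsf g X) = legsf g (map_mx f X).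
Proof.
apply: tmxP => a b; rewrite map_tent !tentE map_tent.
by case: ifP => // _; rewrite rmorph0.
Qed.

Lemma map_adj N (A B : pzRingType) (f : {rmorphism A -> B}) k i (X : tmx N 2 A) :
  map_mx f (adj k X i) = adj k (map_mx f X) i.
Proof.
have [ki|ik] := leqP k i.+1; first by rewrite !adj_out // map_mx1.
by rewrite -addn2 in ik; rewrite !(adjE _ ik) map_legsf.
Qed.

Lemma map_Tlast N (A B : pzRingType) (f : {rmorphism A -> B}) k (C : 'M[A]_N) (X : tmx N k.+1 A) :
  map_mx f (Tlast C X) = Tlast (map_mx f C) (map_mx f X).
Proof.
apply: tmxP => a b; rewrite map_tent !tent_Tlast rmorph_sum; apply: eq_bigr => x _.
by rewrite rmorph_sum; apply: eq_bigr => y _; rewrite rmorphM map_tent mxE.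
Qed.

Definition first1 N (A : pzRingType) k (X : 'M[A]_N) : tmx N k A :=
  if insub 0%N is Some l then leg1 l X else 1%:M.

Lemma first1E N (A : pzRingType) k (h : (0 < k)%N) (X : 'M[A]_N) : first1 k X = leg1 (Ordinal h) X.
Proof. by rewrite /first1 insubT. Qed.

Lemma emb_first1 N (A : pzRingType) k (X : 'M[A]_N) : (0 < k)%N -> emb (first1 k X) = first1 k.+1 X.
Proof.
move=> h; rewrite !first1E emb_leg1; congr leg1; exact: val_inj.
Qed.

Lemma adj_first1_comm N (A : pzRingType) k (X : tmx N 2 A) (Y : 'M[A]_N) i : (0 < i)%N ->
  (forall i j i' j', GRing.comm (X i j) (Y i' j')) ->
  adj k X i *m first1 k Y = first1 k Y *m adj k X i.
Proof.
case: k => [|k] i0 XY; first by rewrite adj_out // mul1mx mulmx1.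
by rewrite first1E; exact: adj_leg1_comm.
Qed.

(** * Braid words carrying strands across several others *)

Section BraidWords.
Variables (F : fieldType) (N : nat) (R : tmx N 2 F).
Hypothesis braidR :
  adj 3 R 0 *m adj 3 R 1 *m adj 3 R 0 = adj 3 R 1 *m adj 3 R 0 *m adj 3 R 1.
Hypothesis uR : R \in unitmx.
Variable n : nat.
Local Notation Ra i := (adj n R i).
Local Notation Va i := (adj n (invmx R) i).

Lemma adjV i : Va i *m Ra i = 1%:M.
Proof. by rewrite -adjM mulVmx // adj_id. Qed.

Lemma adjK i : Ra i *m Va i = 1%:M.
Proof. by rewrite -adjM mulmxV // adj_id. Qed.

Lemma invmx_adj i : invmx (Ra i) = Va i.
Proof.
have u : Ra i \in unitmx by case/mulmx1_unit: (adjK i).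
by rewrite -[LHS]mulmx1 -(adjK i) mulKmx.
Qed.

Lemma inv_comm m (X Xi Y : 'M[F]_m) :
  X *m Xi = 1%:M -> Xi *m X = 1%:M -> X *m Y = Y *m X -> Xi *m Y = Y *m Xi.
Proof.
move=> XXi XiX XY; rewrite -[LHS]mulmx1 -XXi -!mulmxA (mulmxA Y) -XY.
by rewrite !mulmxA XiX mul1mx.
Qed.

(** [down j] is $R_{j-1}\cdots R_0$ and [downs j] is its shift $R_j\cdots R_1$. Conjugation by
    [down j] produces the upper copies, while [downs j] avoids factor 0. *)
Fixpoint down j : tmx N n F := if j is j'.+1 then Ra j' *m down j' else 1%:M.
Fixpoint downV j : tmx N n F := if j is j'.+1 then downV j' *m Va j' else 1%:M.
Fixpoint downs j : tmx N n F := if j is j'.+1 then Ra j *m downs j' else 1%:M.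
Fixpoint downsV j : tmx N n F := if j is j'.+1 then downsV j' *m Va j else 1%:M.

Lemma downK j : down j *m downV j = 1%:M.
Proof.
elim: j => [|j IH]; first by rewrite mulmx1.
by rewrite /= -mulmxA (mulmxA (down j)) IH mul1mx adjK.
Qed.

Lemma downVK j : downV j *m down j = 1%:M.
Proof.
elim: j => [|j IH]; first by rewrite mulmx1.
by rewrite /= -mulmxA (mulmxA (Va j)) adjV mul1mx.
Qed.

Lemma downsK j : downs j *m downsV j = 1%:M.
Proof.
elim: j => [|j IH]; first by rewrite mulmx1.
by rewrite /= -mulmxA (mulmxA (downs j)) IH mul1mx adjK.
Qed.

Lemma downsVK j : downsV j *m downs j = 1%:M.
Proof.
elim: j => [|j IH]; first by rewrite mulmx1.
by rewrite /= -mulmxA (mulmxA (Va j.+1)) adjV mul1mx.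
Qed.

Lemma adj_down_comm i j : (j <= i)%N -> Ra i.+1 *m down j = down j *m Ra i.+1.
Proof.
elim: j => [|j IH] ji; first by rewrite mulmx1 mul1mx.
rewrite /= mulmxA -(@adj_comm _ _ n R R j) // => [|*]; last exact: mulrC.
by rewrite -!mulmxA IH // ltnW.
Qed.

Lemma adj_downV_comm i j : (j <= i)%N -> Ra i.+1 *m downV j = downV j *m Ra i.+1.
Proof.
by move=> ji; apply/esym/(inv_comm (downK j) (downVK j)); rewrite adj_down_comm.
Qed.

(** As a braid, [down j *m downs j] carries two neighbouring strands together across [j] others, so
    a crossing of these two can slide from one end to the other. *)
Lemma down_downs j : (j.+1 < n)%N -> Ra j *m down j *m downs j = down j *m downs j *m Ra 0.
Proof.
elim: j => [|j IH] jn; first by rewrite /= !mulmx1 mul1mx.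
rewrite /= !mulmxA -(mulmxA (Ra j.+1 *m Ra j)) -adj_down_comm // mulmxA.
rewrite -adj_braid // -(mulmxA (Ra j)) -(mulmxA (Ra j)) -(mulmxA (Ra j)).
rewrite -(mulmxA (Ra j.+1)) -(mulmxA (Ra j.+1)) IH; last exact: ltnW.
by rewrite !mulmxA -(mulmxA (Ra j) (Ra j.+1)) adj_down_comm // !mulmxA.
Qed.

Lemma down_adj_conj j : (j.+1 < n)%N ->
  downV j *m Ra j *m down j = downs j *m Ra 0 *m downsV j.
Proof.
move=> jn; rewrite -[LHS]mulmx1 -(downsK j) !mulmxA; congr (_ *m _).
by rewrite -!mulmxA (mulmxA (Ra j)) down_downs // !mulmxA downVK mul1mx.
Qed.

Lemma down_downsV j : (j.+1 < n)%N -> Va j *m down j *m downs j = down j *m downs j *m Va 0.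
Proof.
move=> jn; rewrite -[LHS]mulmx1 -(adjK 0) [LHS]mulmxA; congr (_ *m _).
by rewrite -!mulmxA (mulmxA (down j)) -down_downs // !mulmxA adjV mul1mx.
Qed.

Lemma downsV_downV j : (j.+1 < n)%N -> downsV j *m downV j *m Va j = Va 0 *m downsV j *m downV j.
Proof.
move=> jn; have /(congr1 (fun X => downsV j *m downV j *m Va j *m X *m Va 0 *m downsV j *m downV j)) :=
  down_downs jn.
rewrite !mulmxA -!(mulmxA _ (Ra 0)) adjK mulmx1.
rewrite -(mulmxA _ (Va j) (Ra j)) adjV mulmx1 -(mulmxA _ (downV j) (down j)) downVK mulmx1.
rewrite downsVK mul1mx => ->.
rewrite -(mulmxA _ (downs j) (downsV j)) downsK mulmx1.
by rewrite -(mulmxA _ (down j) (downV j)) downK mulmx1.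
Qed.

End BraidWords.

Lemma in_alg_comm (F : fieldType) (A : algType F) c (x : A) : GRing.comm (in_alg A c) x.
Proof. by rewrite /GRing.comm in_algE mulr_algl mulr_algr. Qed.

Lemma map_alg_mxM (F : fieldType) (A : algType F) m n p (X : 'M[F]_(m, n)) (Y : 'M[F]_(n, p)) :
  map_mx (in_alg A) (X *m Y) = map_mx (in_alg A) X *m map_mx (in_alg A) Y.
Proof. exact: map_mxM. Qed.

Lemma map_alg_mx1 (F : fieldType) (A : algType F) n :
  map_mx (in_alg A) (1%:M : 'M[F]_n) = 1%:M.
Proof. exact: map_mx1. Qed.

(** * An action with the permutation relation, in matrix form *)

Section MatrixAction.
Variables (F : fieldType) (LA MA : algType F) (act : LA -> MA -> MA).
Hypotheses (act_linl : forall b, linear (act^~ b)) (act_linr : forall a, linear (act a)).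

Lemma act_suml I r (P : pred I) (G : I -> LA) b :
  act (\sum_(i <- r | P i) G i) b = \sum_(i <- r | P i) act (G i) b.
Proof.
pose f : {linear LA -> MA} := HB.pack (act^~ b) (GRing.isLinear.Build _ _ _ _ _ (act_linl b)).
exact: (linear_sum f).
Qed.

Lemma act_sumr I r (P : pred I) (G : I -> MA) a :
  act a (\sum_(i <- r | P i) G i) = \sum_(i <- r | P i) act a (G i).
Proof.
pose f : {linear MA -> MA} := HB.pack (act a) (GRing.isLinear.Build _ _ _ _ _ (act_linr a)).
exact: (linear_sum f).
Qed.

Lemma act_Zl c a b : act (c *: a) b = c *: act a b.
Proof.
pose f : {linear LA -> MA} := HB.pack (act^~ b) (GRing.isLinear.Build _ _ _ _ _ (act_linl b)).
exact: (linearZZ f).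
Qed.

Lemma act_Zr c a b : act a (c *: b) = c *: act a b.
Proof.
pose f : {linear MA -> MA} := HB.pack (act a) (GRing.isLinear.Build _ _ _ _ _ (act_linr a)).
exact: (linearZZ f).
Qed.

Lemma act_0l b : act 0 b = 0.
Proof. by have:= act_Zl 0 0 b; rewrite !scale0r. Qed.

Lemma act_0r a : act a 0 = 0.
Proof. by have:= act_Zr 0 a 0; rewrite !scale0r. Qed.

Local Notation scL := (map_mx (in_alg LA)).
Local Notation scM := (map_mx (in_alg MA)).
Local Notation mxact := (bmul act).

Lemma mxactZl n (S : 'M[F]_n) X Y : mxact (scL S *m X) Y = scM S *m mxact X Y.
Proof.
apply/matrixP=> i j; rewrite !mxE.
under eq_bigr do rewrite mxE act_suml.
under [RHS]eq_bigr do rewrite [X in X * _]mxE [X in _ * X]mxE mulr_sumr.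
rewrite exchange_big; apply: eq_bigr => k _; apply: eq_bigr => l _.
by rewrite mxE !in_algE !mulr_algl act_Zl.
Qed.

Lemma mxactZm n (S : 'M[F]_n) X Y : mxact (X *m scL S) Y = mxact X (scM S *m Y).
Proof.
apply/matrixP=> i j; rewrite !mxE.
under eq_bigr do rewrite mxE act_suml.
under [RHS]eq_bigr do rewrite mxE act_sumr.
rewrite exchange_big; apply: eq_bigr => k _; apply: eq_bigr => l _.
by rewrite !mxE !in_algE mulr_algl mulr_algr act_Zl act_Zr.
Qed.

Lemma mxactZr n (S : 'M[F]_n) X Y : mxact X (Y *m scM S) = mxact X Y *m scM S.
Proof.
apply/matrixP=> i j; rewrite !mxE.
under eq_bigr do rewrite mxE act_sumr.
under [RHS]eq_bigr do rewrite [X in X * _]mxE mulr_suml.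
rewrite exchange_big; apply: eq_bigr => k _; apply: eq_bigr => l _.
by rewrite mxE !in_algE !mulr_algr act_Zr.
Qed.

(** The relation is available behind one element [b]; taking for [b] the entries of [B] in turn and
    summing gives it behind a matrix. *)
Lemma mxact_exchange n (X X' : 'M[LA]_n) (Y Y' : 'M[MA]_n) B :
  (forall b, bmul (fun a m => act a (m * b)) X Y = bmul (fun m a => m * act a b) Y' X') ->
  mxact X (Y *m B) = Y' *m mxact X' B.
Proof.
move=> E; apply/matrixP=> i j; rewrite !mxE.
under eq_bigr do rewrite mxE act_sumr.
under [RHS]eq_bigr do rewrite mxE mulr_sumr.
rewrite exchange_big [RHS]exchange_big; apply: eq_bigr => l _.
by have:= congr1 (fun X : 'M[MA]_n => X i l) (E (B l j)); rewrite !mxE.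
Qed.

Lemma mxact_scalar n w (Y : 'M[MA]_n) : mxact w%:M Y = map_mx (act w) Y.
Proof.
apply/matrixP=> i j; rewrite !mxE (bigD1 i) //= big1 ?addr0 => [|k ki].
  by rewrite mxE eqxx mulr1n.
by rewrite mxE eq_sym (negPf ki) mulr0n act_0l.
Qed.

(** The argument of the action is the identity on the last factor, so the trace over that factor
    falls on the operator alone. *)
Lemma Tlast_mxact N (C : 'M[F]_N) k (X : tmx N k.+1 LA) (Y : tmx N k MA) :
  Tlast (scM C) (mxact X (emb Y)) = mxact (Tlast (scL C) X) Y.
Proof.
apply: tmxP => a b; rewrite tent_Tlast tent_bmul.
under [RHS]eq_bigr do rewrite tent_Tlast act_suml.
rewrite [RHS]exchange_big; apply: eq_bigr => x _.
under [RHS]eq_bigr do rewrite act_suml.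
rewrite [RHS]exchange_big; apply: eq_bigr => y _.
rewrite tent_bmul sum_ins (bigD1 x) //= [X in _ + X]big1 ?addr0 => [|z zx].
  rewrite mulr_sumr; apply: eq_bigr => c _; rewrite tent_emb eqxx !mxE !in_algE.
  by rewrite !mulr_algl act_Zl.
by rewrite big1 // => c _; rewrite tent_emb (negPf zx) act_0r.
Qed.

Variables (N : nat) (R : tmx N 2 F) (Lm : 'M[LA]_N) (Mm : 'M[MA]_N).
Hypothesis braidR :
  adj 3 R 0 *m adj 3 R 1 *m adj 3 R 0 = adj 3 R 1 *m adj 3 R 0 *m adj 3 R 1.
Hypothesis uR : R \in unitmx.
Hypothesis act_gen : forall b,
  bmul (fun a m => act a (m * b)) (scL R *m leg1 ord0 Lm *m scL R) (leg1 ord0 Mm) =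
  bmul (fun m a => m * act a b) (leg1 ord0 Mm) (scL R *m leg1 ord0 Lm *m scL (invmx R)).
Hypothesis act_Lm1 : forall i j, act (Lm i j) 1 = (i == j)%:R.

Section Powers.
Variable n : nat.
Local Notation Ra i := (adj n R i).
Local Notation Va i := (adj n (invmx R) i).
Local Notation L1 := (first1 n Lm).
Local Notation M1 := (first1 n Mm).
Local Notation down := (@down F N R n).
Local Notation downV := (@downV F N R n).
Local Notation downs := (@downs F N R n).
Local Notation downsV := (@downsV F N R n).

(** The permutation relation on two factors, placed on the first two of [n]; [legsf_bmul] applies
    because both of its sides are products along a pairing. *)
Lemma mxact_L1M1 B : (1 < n)%N ->
  mxact (scL (Ra 0) *m L1 *m scL (Ra 0)) (M1 *m B) =
  M1 *m mxact (scL (Ra 0) *m L1 *m scL (Va 0)) B.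
Proof.
move=> n1; have h : (0 + 2 <= n)%N by [].
have leg (A : pzRingType) (X : 'M[A]_N) : first1 n X = legsf (slot h) (leg1 ord0 X : tmx N 2 A).
  rewrite (first1E (ltnW n1)) [LHS]leg1E [leg1 ord0 X in RHS]leg1E legsf_comp; last exact: slot_inj.
  by apply: eq_legsf => l; apply: val_inj.
have I : injective (slot h) by apply: slot_inj.
apply: mxact_exchange => b; rewrite !map_adj !leg !(adjE _ h) -!legsfM //.
rewrite -!legsf_bmul ?act_gen // => [x|x|x|x].
- by rewrite mul0r.
- by rewrite act_0l mulr0.
- by rewrite act_0l.
- by rewrite mul0r act_0r.
Qed.

Lemma scM_first1_comm i : (0 < i)%N -> scM (Ra i) *m M1 = M1 *m scM (Ra i).
Proof.
move=> i0; rewrite map_adj; apply: adj_first1_comm => // *.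
by rewrite mxE; exact: in_alg_comm.
Qed.

Lemma scL_first1_comm i : (0 < i)%N -> scL (Ra i) *m L1 = L1 *m scL (Ra i).
Proof.
move=> i0; rewrite map_adj; apply: adj_first1_comm => // *.
by rewrite mxE; exact: in_alg_comm.
Qed.

Lemma downs_M1 j : scM (downs j) *m M1 = M1 *m scM (downs j).
Proof.
elim: j => [|j IH]; first by rewrite map_alg_mx1 mul1mx mulmx1.
by rewrite [downs _]/= !map_alg_mxM -mulmxA IH !mulmxA scM_first1_comm.
Qed.

Lemma downs_L1 j : scL (downs j) *m L1 = L1 *m scL (downs j).
Proof.
elim: j => [|j IH]; first by rewrite map_alg_mx1 mul1mx mulmx1.
by rewrite [downs _]/= !map_alg_mxM -mulmxA IH !mulmxA scL_first1_comm.
Qed.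

Lemma downsV_M1 j : scM (downsV j) *m M1 = M1 *m scM (downsV j).
Proof.
rewrite -[LHS]mulmx1 -(map_alg_mx1 MA) -(downsK uR n j) map_alg_mxM.
rewrite -!mulmxA (mulmxA M1) -downs_M1 !mulmxA -map_alg_mxM downsVK // map_alg_mx1.
by rewrite mul1mx.
Qed.

(** The copy $M_{\overline{i+1}}$ with its conjugations collected. The number [n] of factors is
    independent of the number of copies multiplied, which leaves room for [L] in the next
    position. *)
Definition Mcopy i : tmx N n MA := scM (down i) *m M1 *m scM (downV i).
Definition Mprod j : tmx N n MA := \big[mulmx/1%:M]_(i < j) Mcopy i.

(** The lower copy $L_{\underline{j+1}}$. *)
Fixpoint Lcopy j : tmx N n LA :=
  if j is j'.+1 then scL (Va j') *m Lcopy j' *m scL (Ra j') else L1.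
(** The inverse of $J_{j+1}$, by the Jucys-Murphy recursion for $R^{-1}$; see [rho_JM]. *)
Fixpoint Jinv j : tmx N n F :=
  if j is j'.+1 then Va j' *m Jinv j' *m Va j' else 1%:M.

Lemma MprodS j : Mprod j.+1 = Mprod j *m Mcopy j.
Proof. exact: big_ord_recr. Qed.

Lemma adj_Mcopy_comm i j : (i < j)%N -> scM (Ra j) *m Mcopy i = Mcopy i *m scM (Ra j).
Proof.
case: j => // j ij; rewrite /Mcopy !mulmxA -map_alg_mxM adj_down_comm // map_alg_mxM.
rewrite -(mulmxA (scM (down i))) scM_first1_comm // -!mulmxA -!map_alg_mxM.
by rewrite adj_downV_comm.
Qed.

Lemma adj_Mprod_comm i j : (i <= j)%N -> scM (Ra j) *m Mprod i = Mprod i *m scM (Ra j).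
Proof.
elim: i => [|i IH] ij; first by rewrite /Mprod big_ord0 mulmx1 mul1mx.
by rewrite MprodS mulmxA IH 1?ltnW // -(mulmxA (Mprod i) _ (Mcopy i)) adj_Mcopy_comm // mulmxA.
Qed.

Lemma adjV_Mprod_comm i j : (i <= j)%N -> scM (Va j) *m Mprod i = Mprod i *m scM (Va j).
Proof.
move=> ij; rewrite -[LHS]mulmx1 -(map_alg_mx1 MA) -(adjK uR n j) map_alg_mxM.
rewrite -!mulmxA (mulmxA (Mprod i)) -adj_Mprod_comm // !mulmxA -map_alg_mxM adjV // map_alg_mx1.
by rewrite mul1mx.
Qed.

(** With $\bar L,\bar M$ the upper copies at position $j$, this is $R_j\bar LR_j\rhd(\bar MB)=\bar
    M\,(R_j\bar LR_j^{-1}\rhd B)$ solved for $\bar L\rhd(R_j\bar MB)$. It is the relation on the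
    first two factors conjugated by [down j *m downs j], which turns $R_0$ into $R_j$; as [downs j]
    commutes with $L_1$ and $M_1$, these become $\bar L$ and $\bar M$. *)
Lemma mxact_L1_down j B : (j.+1 < n)%N ->
  mxact (scL (down j) *m L1 *m scL (downV j)) (scM (Ra j) *m Mcopy j *m B) =
  scM (Va j) *m Mcopy j *m scM (Ra j) *m
  mxact (scL (down j) *m L1 *m scL (downV j)) (scM (Va j) *m B).
Proof.
move=> jn; have n1 : (1 < n)%N by apply: leq_ltn_trans jn.
set B' := scM (downsV j *m downV j) *m B.
have E1 : scM (downV j) *m (scM (Ra j) *m Mcopy j *m B) =
    scM (downs j) *m scM (Ra 0) *m (M1 *m B').
  rewrite /Mcopy /B' !mulmxA -!map_alg_mxM down_adj_conj // !map_alg_mxM !mulmxA.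
  by rewrite -(mulmxA _ (scM (downsV j)) M1) downsV_M1 !mulmxA.
have E2 Y : mxact (scL (down j) *m L1 *m scL (downV j)) Y =
    scM (down j) *m mxact L1 (scM (downV j) *m Y).
  by rewrite -mulmxA mxactZl mxactZm.
rewrite !E2 E1 -mulmxA -mxactZm -downs_L1 mxactZl -mxactZm.
(* The relation requires an $R_0$ on the left of $L_1$ as well; the compensating $R_0^{-1}$ becomes
   the leading $R_j^{-1}$ of the result. *)
have -> : L1 *m scL (Ra 0) = scL (Va 0) *m (scL (Ra 0) *m L1 *m scL (Ra 0)).
  by rewrite !mulmxA -map_alg_mxM adjV // map_alg_mx1 mul1mx.
rewrite mxactZl mxact_L1M1 // -!mulmxA mxactZl mxactZm !mulmxA.
have <- : scM (down j *m downs j *m Va 0) = scM (down j) *m scM (downs j) *m scM (Va 0).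
  by rewrite !map_alg_mxM.
rewrite -down_downsV // /Mcopy !map_alg_mxM -!mulmxA; congr (_ *m (_ *m _)).
have E3 : scM (downV j) *m (scM (Ra j) *m (scM (down j) *m mxact L1 (scM (downV j) *m (scM (Va j) *m B)))) =
   scM (downs j) *m (scM (Ra 0) *m mxact L1 (scM (downsV j) *m (scM (downV j) *m (scM (Va j) *m B)))).
  rewrite -[mxact L1 (scM (downsV j) *m _)]mxactZm.
  have -> : L1 *m scL (downsV j) = scL (downsV j) *m L1.
    rewrite -[RHS]mulmx1 -(map_alg_mx1 LA) -(downsK uR n j) map_alg_mxM.
    rewrite -!mulmxA (mulmxA L1) -downs_L1 !mulmxA -map_alg_mxM downsVK // map_alg_mx1.
    by rewrite mul1mx.
  rewrite mxactZl !mulmxA -!map_alg_mxM; congr (scM _ *m _).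
  by rewrite down_adj_conj // !mulmxA.
rewrite E3 (mulmxA (scM (downs j)) M1) downs_M1 -!mulmxA; congr (_ *m (_ *m (_ *m _))).
by rewrite !mulmxA -!map_alg_mxM downsV_downV.
Qed.

(** The lower copy of [L] enters on the left and the upper copy emerges on the right. The free tail
    [B] is what the induction needs, since the copies of [M] are split off one at a time and become
    part of it. *)
Lemma mxact_Lcopy j B : (j < n)%N ->
  mxact (Lcopy j) (Mprod j *m B) =
  scM (Jinv j) *m Mprod j *m mxact (scL (down j) *m L1 *m scL (downV j)) B.
Proof.
elim: j B => [|j IH] B jn; first by rewrite /Mprod big_ord0 !map_alg_mx1 !mul1mx mulmx1.
rewrite MprodS [Lcopy _]/= -(mulmxA (scL (Va j))) mxactZl [mxact (Lcopy j *m _) _]mxactZm.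
have -> : scM (Ra j) *m (Mprod j *m Mcopy j *m B) = Mprod j *m (scM (Ra j) *m Mcopy j *m B).
  by rewrite !mulmxA adj_Mprod_comm.
rewrite IH; last exact: ltnW.
have E : scL (down j.+1) = scL (Ra j) *m scL (down j) by rewrite -map_alg_mxM.
have EV : scL (downV j.+1) = scL (downV j) *m scL (Va j) by rewrite -map_alg_mxM.
have EJ : scM (Jinv j.+1) = scM (Va j) *m scM (Jinv j) *m scM (Va j).
  by rewrite -!map_alg_mxM.
rewrite mxact_L1_down // E EV EJ.
have -> : scL (Ra j) *m scL (down j) *m L1 *m (scL (downV j) *m scL (Va j)) =
    scL (Ra j) *m (scL (down j) *m L1 *m scL (downV j) *m scL (Va j)).
  by rewrite !mulmxA.
rewrite mxactZl [mxact (_ *m scL (Va j)) B]mxactZm !mulmxA; congr (_ *m _ *m _ *m _).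
by rewrite -!(mulmxA (scM (Va j) *m scM (Jinv j))) adjV_Mprod_comm.
Qed.

Lemma mxact_L11 : (0 < n)%N -> mxact L1 1%:M = 1%:M.
Proof.
move=> n0; apply: tmxP => a b; rewrite tent_bmul (bigD1 b) //= big1 ?addr0 => [|c cb].
  rewrite [tent _ b b]tent1 eqxx (first1E n0) -(@leg11 N MA n (Ordinal n0)) !tentE mxE.
  by case: ifP => _; rewrite ?act_Lm1 ?act_0l.
by rewrite tent1 (negPf cb) act_0r.
Qed.

Lemma mxact_Lcopy_Mprod j : (j < n)%N -> mxact (Lcopy j) (Mprod j) = scM (Jinv j) *m Mprod j.
Proof.
move=> jn; have n0 : (0 < n)%N by apply: leq_ltn_trans jn.
rewrite -[Mprod j in LHS]mulmx1 mxact_Lcopy // -[RHS]mulmx1; congr (_ *m _).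
rewrite -mulmxA mxactZl mxactZm mulmx1 -[scM (downV j)]mul1mx mxactZr mxact_L11 // mul1mx.
by rewrite -map_alg_mxM downK // map_alg_mx1.
Qed.

End Powers.

End MatrixAction.

(** * Tracing the last factor in the action on products of M *)

Section PowersOfM.
Variables (F : fieldType) (LA MA : algType F) (act : LA -> MA -> MA).
Hypotheses (act_linl : forall b, linear (act^~ b)) (act_linr : forall a, linear (act a)).
Variables (N : nat) (q : F) (R Psi : tmx N 2 F).
Hypotheses (gen_q : generic q) (hR : hecke_symmetry q R) (RPsi : skew_inverse R Psi).
Hypothesis ev : even_of_rank q R N.
Local Notation scL := (map_mx (in_alg LA)).
Local Notation scM := (map_mx (in_alg MA)).
Local Notation C := (Cmx Psi).
Local Notation nu := (q - q^-1).

Let uR : R \in unitmx. Proof. exact: R_unit hR. Qed.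
Let SR : invmx R *m R = 1%:M. Proof. exact: mulVmx. Qed.
Let RS : R *m invmx R = 1%:M. Proof. exact: mulmxV. Qed.
Let braidR := hR.1.

Variables (Lm : 'M[LA]_N) (Mm : 'M[MA]_N).

(** The bound matters: [adj n R i] defaults to 1 when factor [i.+1] is missing, whereas on one more
    factor it may be a genuine [R]. *)
Lemma emb_down n j : (j < n)%N -> emb (down R n j) = down R n.+1 j.
Proof.
elim: j => [|j IH] jn; first exact: emb1.
by rewrite [down R n _]/= embM emb_adj // IH // ltnW.
Qed.

Lemma emb_downV n j : (j < n)%N -> emb (downV R n j) = downV R n.+1 j.
Proof.
elim: j => [|j IH] jn; first exact: emb1.
by rewrite [downV R n _]/= embM emb_adj // IH // ltnW.
Qed.

Lemma emb_map (A : algType F) n (X : tmx N n F) :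
  emb (map_mx (in_alg A) X) = map_mx (in_alg A) (emb X).
Proof. by rewrite [RHS]map_legsf. Qed.

Lemma emb_Mcopy n j : (j < n)%N -> emb (Mcopy R Mm n j) = Mcopy R Mm n.+1 j.
Proof.
move=> jn; rewrite /Mcopy !embM !emb_map emb_down // emb_downV // emb_first1 //.
exact: leq_ltn_trans jn.
Qed.

Lemma emb_Mprod n j : (j <= n)%N -> emb (Mprod R Mm n j) = Mprod R Mm n.+1 j.
Proof.
elim: j => [|j IH] jn; first by rewrite /Mprod !big_ord0 emb1.
by rewrite !MprodS embM IH ?emb_Mcopy // ltnW.
Qed.

Lemma emb_Lcopy n j : (j < n)%N -> emb (Lcopy R Lm n j) = Lcopy R Lm n.+1 j.
Proof.
elim: j => [|j IH] jn; first exact: emb_first1.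
by rewrite [Lcopy _ _ n _]/= !embM !emb_map !emb_adj // IH // ltnW.
Qed.

Lemma emb_Jinv n j : (j < n)%N -> emb (Jinv R n j) = Jinv R n.+1 j.
Proof.
elim: j => [|j IH] jn; first exact: emb1.
by rewrite [Jinv _ n _]/= !embM !emb_adj // IH // ltnW.
Qed.

(** A lower copy is an iterated conjugate of the form treated in [Tlast_conj], so each step only
    moves the trace one factor to the left. *)
Lemma Tlast_Lcopy k : Tlast (scL C) (Lcopy R Lm k.+1 k) = (Rtr C Lm)%:M.
Proof.
elim: k => [|k IH].
  rewrite [Lcopy _ _ _ _]/= (first1E (ltn0Sn 0)) (_ : Ordinal _ = ord_max) ?Tlast_leg1 //.
  exact: val_inj.
rewrite [Lcopy _ _ _ _]/= -emb_Lcopy // !map_adj Tlast_conj // IH.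
exact: emb_scalar.
Qed.

(** Only the right-hand $R^{-1}$ of the recursion is expanded: the term with [R] then falls under
    [Tlast_conj], and the other contributes the traced $R^{-1}$, that is $q^{-2N}$, times the
    preceding inverse. *)
Lemma Tlast_Jinv k : Tlast (scM C) (scM (Jinv R k.+1 k)) =
  scM ((\tr C)%:M - (nu * q ^- (2 * N)) *: \sum_(i < k) Jinv R k i).
Proof.
elim: k => [|k IH].
  by rewrite big_ord0 scaler0 subr0 -map_Tlast Tlast1.
have E : Jinv R k.+2 k.+1 = adj k.+2 (invmx R) k *m emb (Jinv R k.+1 k) *m adj k.+2 R k -
    nu *: (adj k.+2 (invmx R) k *m emb (Jinv R k.+1 k)).
  have V : adj k.+2 (invmx R) k = adj k.+2 R k - nu%:M.
    by rewrite (invmx_R gen_q hR) adj_shift.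
  by rewrite [Jinv _ _ _]/= -emb_Jinv // {2}V mulmxBr mul_mx_scalar.
set W := nu *: _ in E; have TW : Tlast C W = (nu * q ^- (2 * N)) *: Jinv R k.+1 k.
  rewrite /W -mul_scalar_mx -(emb_scalar N k.+1 nu) Tlast_embl => [|i j x]; last exact: mulrC.
  by rewrite Tlast_embr (Tlast_adjV gen_q hR) // mulmxA -scalar_mxM mul_scalar_mx.
have scE (X : tmx N k.+2 F) : Tlast (scM C) (scM X) = scM (Tlast C X) by rewrite -map_Tlast.
rewrite E map_mxB TlastB (scE W) TW !map_alg_mxM -emb_map !map_adj (Tlast_conj RPsi) // IH emb_map.
rewrite -map_mxB embB emb_scalar embZ -addrA -opprD -scalerDr big_ord_recr /=.
rewrite (big_morph _ (@embD _ _ _) (@emb0 _ _ _)).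
have S : \sum_(i < k) emb (Jinv R k i) = \sum_(i < k) Jinv R k.+1 i.
  by apply: eq_bigr => i _; rewrite emb_Jinv.
by rewrite S.
Qed.

Hypothesis act_gen : forall b,
  bmul (fun a m => act a (m * b)) (scL R *m leg1 ord0 Lm *m scL R) (leg1 ord0 Mm) =
  bmul (fun m a => m * act a b) (leg1 ord0 Mm) (scL R *m leg1 ord0 Lm *m scL (invmx R)).
Hypothesis act_Lm1 : forall i j, act (Lm i j) 1 = (i == j)%:R.

Lemma act_Rtr_Mprod k : map_mx (act (Rtr C Lm)) (Mprod R Mm k k) =
  scM ((\tr C)%:M - (nu * q ^- (2 * N)) *: \sum_(i < k) Jinv R k i) *m Mprod R Mm k k.
Proof.
rewrite -mxact_scalar // -Tlast_Lcopy -Tlast_mxact // emb_Mprod //.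
by rewrite (mxact_Lcopy_Mprod act_linl act_linr braidR uR) // -emb_Mprod // Tlast_embr Tlast_Jinv.
Qed.

Lemma map_alg_scalar (A : algType F) n (c : F) :
  map_mx (in_alg A) (c%:M : 'M[F]_n) = (c%:A)%:M.
Proof. exact: map_scalar_mx. Qed.

Lemma Rtr_shift (Lh : 'M[LA]_N) : Lm = 1%:M - in_alg LA nu *: Lh ->
  Rtr C Lm = (\tr C)%:A - nu *: Rtr C Lh.
Proof.
move=> ->; rewrite /Rtr mulmxBr mulmx1 raddfB /= trace_map_mx; congr (_ - _).
rewrite -mul_scalar_mx -map_alg_scalar mulmxA -map_alg_mxM mul_mx_scalar -mul_scalar_mx.
by rewrite map_alg_mxM map_alg_scalar -mulmxA mul_scalar_mx mxtraceZ mulr_algl.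
Qed.

(** The unit acts trivially, so $\mathrm{Tr}\,C$ drops out on both sides, and the common factor
    $q-q^{-1}$ is nonzero for generic $q$. *)
Lemma act_Rtr_hat k (Lh : 'M[LA]_N) : Lm = 1%:M - in_alg LA nu *: Lh ->
  (forall b, act 1 b = b) ->
  map_mx (act (Rtr C Lh)) (Mprod R Mm k k) =
  scM (q ^- (2 * N) *: \sum_(i < k) Jinv R k i) *m Mprod R Mm k k.
Proof.
move=> /Rtr_shift E act1; have H := act_Rtr_Mprod k; apply/matrixP=> i j.
have:= congr1 (fun X : 'M[MA]_#|{ffun 'I_k -> 'I_N}| => X i j) H.
set S := \sum_(i < k) _; rewrite /= map_mxB mulmxBl map_alg_scalar mul_scalar_mx.
rewrite -scalerA -[nu *: _]mul_scalar_mx map_alg_mxM map_alg_scalar -mulmxA mul_scalar_mx.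
set Y := scM _ *m Mprod _ _ _ _; rewrite !mxE -!/(Y i j) !mulr_algl E.
have -> : act ((\tr C)%:A - nu *: Rtr C Lh) (Mprod R Mm k k i j) =
    (\tr C) *: Mprod R Mm k k i j - nu *: act (Rtr C Lh) (Mprod R Mm k k i j).
  by rewrite addrC -scaleNr act_linl (act_Zl act_linl (\tr C) 1) act1 scaleNr addrC.
by move/addrI/oppr_inj/(scalerI (nu_neq0 gen_q)) ->.
Qed.

End PowersOfM.

(** * Eigenvectors obtained from the full R-trace *)

Section LinearRtrs.
Variables (F : fieldType) (A : algType F) (N : nat) (C : 'M[F]_N) (f : A -> A).
Hypothesis fl : linear f.
Let f' : {linear A -> A} := HB.pack f (GRing.isLinear.Build _ _ _ _ f fl).

Lemma map_linear_mulmx m n p (X : 'M[F]_(m, n)) (Y : 'M[A]_(n, p)) :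
  map_mx f (map_mx (in_alg A) X *m Y) = map_mx (in_alg A) X *m map_mx f Y.
Proof.
apply/matrixP=> i j; rewrite !mxE -[f _]/(f' _) linear_sum; apply: eq_bigr => k _.
by rewrite !mxE !mulr_algl linearZ.
Qed.

Lemma map_linear_Tlast k (X : tmx N k.+1 A) :
  map_mx f (Tlast (map_mx (in_alg A) C) X) = Tlast (map_mx (in_alg A) C) (map_mx f X).
Proof.
apply: tmxP => a b; rewrite map_tent !tent_Tlast -[f _]/(f' _) linear_sum; apply: eq_bigr => x _.
rewrite linear_sum; apply: eq_bigr => y _.
by rewrite map_tent mxE !mulr_algl linearZ.
Qed.

Lemma linear_Rtrs k (X : tmx N k A) : f (Rtrs C X) = Rtrs C (map_mx f X).
Proof.
elim: k X => [|k IH] X; last by rewrite [RHS]/= -[ptr _ _]/(Tlast _ _) -map_linear_Tlast -IH.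
by rewrite /= /mxtrace -[f _]/(f' _) linear_sum; apply: eq_bigr => i _; rewrite mxE.
Qed.

End LinearRtrs.

Lemma Mcopy0 (F : fieldType) (A : algType F) N (R : tmx N 2 F) (Mm : 'M[A]_N) n :
  Mcopy R Mm n 0 = first1 n Mm.
Proof. by rewrite /Mcopy !map_alg_mx1 mul1mx mulmx1. Qed.

Lemma McopyS (F : fieldType) (A : algType F) N (R : tmx N 2 F) (Mm : 'M[A]_N) n i :
  R \in unitmx ->
  Mcopy R Mm n i.+1 = map_mx (in_alg A) (adj n R i) *m Mcopy R Mm n i *m
    map_mx (in_alg A) (invmx (adj n R i)).
Proof.
move=> uR; rewrite invmx_adj // /Mcopy.
have -> : down R n i.+1 = adj n R i *m down R n i by [].
have -> : downV R n i.+1 = downV R n i *m adj n (invmx R) i by [].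
by rewrite !map_alg_mxM !mulmxA.
Qed.

(** [P] and [C] have entries in the base field, so a linear map passes both and reaches [Q], where
    it produces [S] directly to the right of [P]. *)
Lemma linear_Rtrs_eigen (F : fieldType) (A : algType F) N (C : 'M[F]_N) (f : A -> A) k
    (P S : tmx N k F) (Q : tmx N k A) chi :
  linear f -> map_mx f Q = map_mx (in_alg A) S *m Q -> P *m S = chi *: P ->
  f (Rtrs C (map_mx (in_alg A) P *m Q)) = chi *: Rtrs C (map_mx (in_alg A) P *m Q).
Proof.
move=> fl fQ PS; rewrite linear_Rtrs // map_linear_mulmx // fQ mulmxA -map_alg_mxM PS.
have gl : linear (fun x : A => chi *: x) by move=> c x y; rewrite scalerDr !scalerA mulrC.
rewrite [RHS](linear_Rtrs _ gl); congr Rtrs.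
rewrite -mul_scalar_mx map_alg_mxM -mulmxA map_alg_scalar mul_scalar_mx.
by apply/matrixP=> i j; rewrite [LHS]mxE [RHS]mxE mulr_algl.
Qed.

(** * From the permutation map to the action of the cut-and-join operator *)

Section AbstractDouble.
Variables (F : fieldType) (LA MA : algType F) (ep : {lrmorphism LA -> F^o}).
Variable sigma : {linear tensor LA MA -> tensor MA LA}.
Hypothesis sigma1l : forall b, sigma (tens 1 b) = tens b 1.
Hypothesis sigma1r : forall a, sigma (tens a 1) = tens 1 a.
Hypothesis sigmaM : forall a b b', sigma (tens a (b * b')) =
  tlift (fun x y => tlift (fun z w => tens (x * z) w) (sigma (tens y b'))) (sigma (tens a b)).
Variables (N : nat) (q : F) (R Psi : tmx N 2 F).
Hypotheses (gen_q : generic q) (hR : hecke_symmetry q R) (RPsi : skew_inverse R Psi).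
Hypothesis ev : even_of_rank q R N.
Variables (Lh : 'M[LA]_N) (Mm : 'M[MA]_N).
Hypothesis ep_Lh : forall i j, ep (Lh i j) = 0.
Let Lm : 'M[LA]_N := 1%:M - in_alg LA (q - q^-1) *: Lh.
Hypothesis sigma_gen : forall i j,
  sigma (tmul (Rin R LA *m fst1 Lm *m Rin R LA) (fst1 Mm) i j) =
  tmul (fst1 Mm) (Rin R LA *m fst1 Lm *m map_mx (in_alg LA) (invmx R)) i j.

Lemma ep_Lm i j : ep (Lm i j) = (i == j)%:R.
Proof.
have -> : Lm i j = (i == j)%:R - in_alg LA (q - q^-1) * Lh i j by rewrite !mxE.
by rewrite rmorphB rmorphM /= ep_Lh mulr0 subr0 rmorph_nat.
Qed.

Lemma acts_Rtr_hat k :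
  map_mx (acts ep sigma (Rtr (Cmx Psi) Lh)) (Mprod R Mm k k) =
  map_mx (in_alg MA) (q ^- (2 * N) *: \sum_(i < k) Jinv R k i) *m Mprod R Mm k k.
Proof.
apply: (@act_Rtr_hat F LA MA (acts ep sigma) _ _ N q R Psi gen_q hR RPsi ev Lm) => //.
- exact: acts_linl.
- exact: acts_linr.
- move=> b; apply/matrixP=> i j; rewrite [LHS]mxE [RHS]mxE.
  exact: (acts_exchange ep sigmaM b (sigma_gen i j)).
- by move=> i j; rewrite acts1r // ep_Lm; case: eqP; rewrite ?scale1r ?scale0r.
- exact: acts1l.
Qed.

End AbstractDouble.

Section Concrete.
Variables (F : fieldType) (N : nat) (q : F) (R Psi : tmx N 2 F).
Variable sigma : {linear tensor (Lalg R) (Malg R) -> tensor (Malg R) (Lalg R)}.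
Hypotheses (gen_q : generic q) (hR : hecke_symmetry q R) (RPsi : skew_inverse R Psi).
Hypotheses (ev : even_of_rank q R N) (sigmaP : permutation_map q sigma).
Local Notation eps' := (@eps F N R : {lrmorphism Lalg R -> F^o}).

Lemma Mbar_Mcopy k i : Mbar R k i = Mcopy R (Mmx R) k i.
Proof.
elim: i => [|i IH]; first exact: (esym (Mcopy0 R (Mmx R) k)).
have E := McopyS (Mmx R) k i (R_unit gen_q hR).
by rewrite -IH in E; exact: esym E.
Qed.

Lemma schurE k (X : tmx N k F) :
  schur R Psi X = Rtrs (Cmx Psi) (map_mx (in_alg (Malg R)) X *m Mprod R (Mmx R) k k).
Proof.
have E : \big[mulmx/1%:M]_(i < k) Mbar R k i = Mprod R (Mmx R) k k.
  by apply: eq_bigr => i _; rewrite Mbar_Mcopy.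
by rewrite -E.
Qed.

Lemma actE a b : act sigma a b = acts eps' sigma a b.
Proof. by rewrite /act /acts; apply: eq_tlift => x y; reflexivity. Qed.

Lemma eps_Lhat i j : eps (Lhat R i j) = 0.
Proof. by rewrite mxE; exact: palg_aug_gen. Qed.

Lemma act_W1_Mprod k :
  map_mx (act sigma (W1 R Psi)) (Mprod R (Mmx R) k k) =
  map_mx (in_alg (Malg R)) (q ^- (2 * N) *: \sum_(i < k) Jinv R k i) *m Mprod R (Mmx R) k k.
Proof.
case: sigmaP => s1 s2 _ s4 s5.
have := @acts_Rtr_hat F (Lalg R) (Malg R) eps' sigma s1 s2 s4 N q R Psi gen_q hR RPsi ev
  (Lhat R) (Mmx R) eps_Lhat s5 k.
by move=> <-; apply: eq_map_mx => b; rewrite actE.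
Qed.

Lemma act_W1_schur k (P : tmx N k F) chi :
  P *m (q ^- (2 * N) *: \sum_(i < k) Jinv R k i) = chi *: P ->
  act sigma (W1 R Psi) (schur R Psi P) = chi *: schur R Psi P.
Proof.
move=> PS; rewrite schurE.
have fl : linear (act sigma (W1 R Psi)).
  by move=> c x y; rewrite !actE; exact: (acts_linr eps' sigma (W1 R Psi) c x y).
exact: (linear_Rtrs_eigen _ fl (act_W1_Mprod k) PS).
Qed.

End Concrete.

(** * Eigenvalues and contents *)

Section JucysMurphy.
Variables (F : fieldType) (N : nat) (q : F) (R : tmx N 2 F) (k : nat).
Hypotheses (q0 : q != 0) (uR : R \in unitmx).
Variable rho : {lrmorphism hecke q k -> tmx N k F}.
Hypothesis rhoP : R_representation R rho.

Lemma rho_tau i : (i.+1 < k)%N -> rho (tau q k i) = adj k R i.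
Proof.
move=> ik; have ik' : (i < k.-1)%N by case: (k) ik.
by rewrite /tau insubT; exact: rhoP.
Qed.

Lemma rho_JM i : (i < k)%N -> rho (JM q k i) *m Jinv R k i = 1%:M.
Proof.
elim: i => [|i IH] ik; first by rewrite rmorph1 mulmx1.
have -> : rho (JM q k i.+1) = adj k R i *m rho (JM q k i) *m adj k R i.
  rewrite -(rho_tau ik) [LHS](rmorphM rho (tau q k i * JM q k i)).
  by rewrite (rmorphM rho (tau q k i)).
have -> : Jinv R k i.+1 = adj k (invmx R) i *m Jinv R k i *m adj k (invmx R) i by [].
rewrite !mulmxA -(mulmxA _ (adj k R i) (adj k (invmx R) i)) adjK // mulmx1.
by rewrite -(mulmxA (adj k R i) (rho _)) IH 1?ltnW // mulmx1 adjK.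
Qed.

(** Follows from the eigenvalue of $J_i$ on the right of the idempotent, multiplied by the inverse
    of $J_i$. *)
Lemma young_Jinv (a : 'I_k -> nat * nat) P (i : 'I_k) : young_idempotent a P ->
  rho P *m Jinv R k i = q ^ (- (2 * content (a i))) *: rho P.
Proof.
move=> [_ /(_ i) [_ PJ]].
have /(congr1 (fun X => X *m Jinv R k i)) : rho P *m rho (JM q k i) = q ^ (2 * content (a i)) *: rho P.
  by rewrite -linearZ -PJ rmorphM.
rewrite -mulmxA rho_JM // mulmx1 -scalemxAl => E.
by rewrite [X in _ = _ *: X]E scalerA -expfzDr // addNr expr0z scale1r.
Qed.

End JucysMurphy.

Section Combinatorics.
Variables (F : fieldType) (q : F).
Hypotheses (q0 : q != 0) (nu0 : q - q^-1 != 0).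

(** Multiplied by $q-q^{-1}$ the sum telescopes to $q^{2r+1}-q^{2r+1-2n}$. Rows are counted from 0
    here, so [r.+1] is the usual row number. *)
Lemma sum_row (r n : nat) :
  \sum_(j < n) q ^ (- (2 * content (r, j : nat))) =
  q ^ (- (n%:Z + 1 - 2 * r.+1%:Z)) * qnum q n.
Proof.
apply: (mulIf nu0); rewrite /qnum mulrA divfK //.
have E m : q ^ (- (m%:Z + 1 - 2 * r.+1%:Z)) * (q ^+ m - q ^- m) =
    q ^ (2 * r%:Z + 1) - q ^ (2 * r%:Z + 1 - 2 * m%:Z).
  rewrite mulrBr exprnP invr_expz -!expfzDr //.
  by congr (q ^ _ - q ^ _); lia.
rewrite E; elim: n => [|n IH]; first by rewrite big_ord0 mul0r mulr0 subr0 subrr.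
rewrite big_ord_recr mulrDl IH /= -addrA; congr (_ + _).
have -> : q^-1 = q ^ (-1) by [].
rewrite mulrBr -[X in _ * X - _]expr1z -!expfzDr // /content /=.
rewrite (_ : - (2 * (n%:Z - r%:Z)) + 1 = 2 * r%:Z + 1 - 2 * n%:Z); last by lia.
by rewrite addKr; congr (- q ^ _); lia.
Qed.

Lemma sum_standard N k (lam : N.-tuple nat) (a : 'I_k -> nat * nat) (V : nmodType)
    (G : nat * nat -> V) : standard lam a ->
  \sum_(i < k) G (a i) = \sum_(i < N) \sum_(j < tnth lam i) G (i : nat, j : nat).
Proof.
move=> [ai aP _ _].
pose s := [seq (i, j) | i <- iota 0 N, j <- iota 0 (nth 0%N lam i)].
transitivity (\sum_(x <- s) G x).
  rewrite -(big_map a predT G) /=; apply: perm_big; apply: uniq_perm.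
  - by rewrite map_inj_uniq // index_enum_uniq.
  - apply: allpairs_uniq_dep; first exact: iota_uniq.
      by move=> i _; exact: iota_uniq.
    by move=> [i j] [i' j'] _ _ /= [-> ->].
  move=> x; apply/mapP/allpairsPdep => [[i _ ->]|[i [j [_ ij ->]]]].
    have h : ((a i).2 < nth 0%N lam (a i).1)%N by apply/aP; exists i.
    exists (a i).1, (a i).2; rewrite !mem_iota /= !add0n h -surjective_pairing; split=> //.
    (* A row beyond the N-th has the default length 0 and thus contains no box. *)
    rewrite ltnNge; apply/negP => le; rewrite nth_default ?size_tuple // in h.
  rewrite mem_iota add0n in ij; have /aP [l E] : ((i, j).2 < nth 0%N lam (i, j).1)%N by [].
  by exists l; rewrite // mem_index_enum.
have iotaE n : iota 0 n = index_iota 0 n by rewrite /index_iota subn0.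
rewrite /s big_allpairs_dep /= iotaE big_mkord; apply: eq_bigr => i _.
by rewrite iotaE big_mkord (tnth_nth 0%N).
Qed.

End Combinatorics.

Theorem proposition10 (Rr : realType) (N : nat) (q : Rr[i])
    (R Psi : tmx N 2 Rr[i])
    (sigma : {linear tensor (Lalg R) (Malg R) -> tensor (Malg R) (Lalg R)})
    (k : nat) (lam : N.-tuple nat) (a : 'I_k -> nat * nat)
    (P : hecke q k) (rho : {lrmorphism hecke q k -> tmx N k Rr[i]}) :
  generic q ->
  GL_type q R N ->
  skew_inverse R Psi ->
  permutation_map q sigma ->
  is_partition lam k ->
  standard lam a ->
  young_idempotent a P ->
  R_representation R rho ->
  let s := schur R Psi (rho P) in
  let chi := q ^- (2 * N) * \sum_(i < k) q ^ (- (2 * content (a i))) in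
  act sigma (W1 R Psi) s = chi *: s /\
  chi = q ^- (2 * N) *
        \sum_(i < N) q ^ (- ((tnth lam i)%:Z + 1 - 2 * i.+1%:Z))
                     * qnum q (tnth lam i).
Proof.
move=> gen_q [hR _ ev] RPsi sigmaP _ std young rep s chi.
have q0 : q != 0 by case: gen_q.
split; last first.
  rewrite /chi (sum_standard (fun x => q ^ (- (2 * content x))) std); congr (_ * _).
  by apply: eq_bigr => i _; apply: sum_row => //; exact: nu_neq0 gen_q.
have PS : rho P *m (q ^- (2 * N) *: \sum_(i < k) Jinv R k i) = chi *: rho P.
  rewrite -scalemxAr mulmx_sumr -scalerA scaler_suml; congr (_ *: _).
  by apply: eq_bigr => i _; exact: (young_Jinv q0 (R_unit gen_q hR) rep i young).
exact: (act_W1_schur gen_q hR RPsi ev sigmaP PS).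
Qed.
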